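(* Let $X$ be a regular CW complex of finite dimension, i.e. $X=X^{(n)}$ for some $n\ge0$. Then $X$ is reflexive: every pre-plot of $X$ is a plot.
   Context: A parametrization of a diffeological space $Y$ is any map $P:U\to Y$ with $U$ open in some $\mathbb{R}^k$; it is a pre-plot if $f\circ P$ is smooth for every smooth $f:Y\to\mathbb{R}$. $Y$ is reflexive if every pre-plot is a plot. An induction is an injective smooth map that is a diffeomorphism onto its image with subset diffeology; $D$-topology: $O\subset Y$ open iff $P^{-1}(O)$ open for all plots $P$. Let $\ell(t)=0$ for $t\le0$, $e^{-1/t}$ for $t>0$; $\alpha_0=\int_0^1\ell(3x)\ell(3-3x)dx$; $\lambda(t)=\frac1{\alpha_0}\int_0^t\ell(3x)\ell(3-3x)dx$; $\phi(t)=\int_0^{1/2+t}\lambda(x)dx$. For integers $n,m\ge0$: $\mathbb{D}^{n,m}=\{(u,v)\in\mathbb{R}^n\times\mathbb{R}^m:\|u\|\ge1-\phi(2-\|u\|-\|v\|)\}$, $\mathbb{S}^{n-1,m}=\{(u,v):\|u\|\ge1\}$ (empty for $n=0$), with subset diffeologies. A fat CW complex is a diffeological space $X$ with subspaces $\emptyset=X^{(-1)}\subset X^{(0)}\subset\cdots$, index sets $J_n$, maps $m_n:J_n\to\mathbb{N}_0$ and smooth maps $h_n:\coprod_{j\in J_n}\mathbb{S}^{n-1,m_n(j)}\to X^{(n-1)}$ such that each $X^{(n)}$ is the pushout in diffeological spaces of the inclusion $\coprod_j\mathbb{S}^{n-1,m_n(j)}\hookrightarrow\coprod_j\mathbb{D}^{n,m_n(j)}$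 and $h_n$, and $X$ is the diffeological colimit of the $X^{(n)}$. It is regular (a regular CW complex) if every $h_n$ is an induction whose image is $D$-open in $X^{(n-1)}$. *)

(* Defs.v *)
From HB Require Import structures.
From mathcomp Require Import all_boot all_order all_algebra.
From mathcomp Require Import all_classical all_reals all_analysis.
Set Implicit Arguments.
Unset Strict Implicit.
Unset Printing Implicit Defensive.
Import Order.TTheory GRing.Theory Num.Theory.
Import numFieldNormedType.Exports.

Local Open Scope classical_set_scope.
Local Open Scope ring_scope.

Section Diffeology.
Variable R : realType.

Fixpoint ideriv (k : nat) (V : normedModType R) (vs : seq 'rV[R]_k)
    (f : 'rV[R]_k -> V) : 'rV[R]_k -> V :=
  match vs with
  | [::] => f
  | v :: vs' => fun x => derive (ideriv vs' f) x v
  end.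

Definition smooth_on (k : nat) (V : normedModType R) (U : set 'rV[R]_k)
    (f : 'rV[R]_k -> V) : Prop :=
  forall (vs : seq 'rV[R]_k) (x : 'rV[R]_k), U x ->
    {for x, continuous (ideriv vs f)} /\ forall v, derivable (ideriv vs f) x v.

Definition extend0 (k : nat) (V : zmodType) (U : set 'rV[R]_k)
    (P : {x | U x} -> V) : 'rV[R]_k -> V :=
  fun x => match pselect (U x) with left h => P (exist _ x h) | right _ => 0 end.

Definition smooth_sub (k : nat) (V : normedModType R) (U : set 'rV[R]_k)
    (P : {x | U x} -> V) : Prop := smooth_on U (extend0 P).
Arguments smooth_sub {k V} U P.

Definition pcomp (k k' : nat) (U : set 'rV[R]_k) (V : set 'rV[R]_k')
    (F : 'rV[R]_k' -> 'rV[R]_k) (hF : forall y, V y -> U (F y))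
    (Y : Type) (P : {x | U x} -> Y) : {y | V y} -> Y :=
  fun y => P (exist _ (F (proj1_sig y)) (hF _ (proj2_sig y))).

Definition prestr (k : nat) (U V : set 'rV[R]_k) (hVU : V `<=` U)
    (Y : Type) (P : {x | U x} -> Y) : {x | V x} -> Y :=
  fun y => P (exist _ (proj1_sig y) (hVU _ (proj2_sig y))).

Record diffeology (Y : Type) := Diffeology {
  plot : forall (k : nat) (U : set 'rV[R]_k), ({x | U x} -> Y) -> Prop;
  plot_open : forall k (U : set 'rV[R]_k) (P : {x | U x} -> Y),
    plot P -> open U;
  plot_const : forall k (U : set 'rV[R]_k) (y : Y),
    open U -> plot (fun _ : {x | U x} => y);
  plot_local : forall k (U : set 'rV[R]_k) (P : {x | U x} -> Y), open U ->
    (forall x : {x | U x}, exists (V : set 'rV[R]_k) (hVU : V `<=` U),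
        open V /\ V (proj1_sig x) /\ plot (prestr hVU P)) ->
    plot P;
  plot_smooth : forall k (U : set 'rV[R]_k) (P : {x | U x} -> Y), plot P ->
    forall k' (V : set 'rV[R]_k') (F : 'rV[R]_k' -> 'rV[R]_k)
      (hF : forall y, V y -> U (F y)),
    open V -> smooth_on V F -> plot (pcomp hF P)
}.

Record dspace := DSpace { dcar :> Type; ddiff : diffeology dcar }.

Definition dplot (Y : dspace) (k : nat) (U : set 'rV[R]_k)
  (P : {x | U x} -> Y) : Prop := plot (ddiff Y) P.

Definition dsmooth (Y Z : dspace) (f : Y -> Z) : Prop :=
  forall k (U : set 'rV[R]_k) (P : {x | U x} -> Y), dplot P -> dplot (f \o P).

Definition smooth_to_R (Y : dspace) (f : Y -> R) : Prop :=
  forall k (U : set 'rV[R]_k) (P : {x | U x} -> Y), dplot P ->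
    smooth_sub U (f \o P).

Definition preplot (Y : dspace) (k : nat) (U : set 'rV[R]_k)
    (P : {x | U x} -> Y) : Prop :=
  open U /\ forall f : Y -> R, smooth_to_R f -> smooth_sub U (f \o P).

Definition dreflexive (Y : dspace) : Prop :=
  forall k (U : set 'rV[R]_k) (P : {x | U x} -> Y), preplot P -> dplot P.

Definition lift_in (Y : Type) (A : set Y) (k : nat) (U : set 'rV[R]_k)
    (P : {x | U x} -> Y) (hA : forall x, A (P x)) : {x | U x} -> {y | A y} :=
  fun x => exist _ (P x) (hA x).

Definition smooth_from_sub (Y Z : dspace) (A : set Y) (g : {y | A y} -> Z) : Prop :=
  forall k (U : set 'rV[R]_k) (P : {x | U x} -> Y) (hA : forall x, A (P x)),
    dplot P -> dplot (g \o lift_in hA).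

Definition eplot (n m k : nat) (U : set 'rV[R]_k)
    (P : {x | U x} -> 'rV[R]_n * 'rV[R]_m) : Prop :=
  open U /\ smooth_sub U (fun x => (P x).1) /\ smooth_sub U (fun x => (P x).2).

Definition smooth_from_esub (n m : nat) (A : set ('rV[R]_n * 'rV[R]_m))
    (Z : dspace) (g : {p | A p} -> Z) : Prop :=
  forall k (U : set 'rV[R]_k) (P : {x | U x} -> 'rV[R]_n * 'rV[R]_m)
    (hA : forall x, A (P x)), eplot P -> dplot (g \o lift_in hA).

Definition D_open_in (X : dspace) (A O : set X) : Prop :=
  O `<=` A /\
  forall k (U : set 'rV[R]_k) (P : {x | U x} -> X), dplot P ->
    (forall x, A (P x)) ->
    open [set x : 'rV[R]_k | exists h : U x, O (P (exist _ x h))].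

Definition ell (t : R) : R := if t <= 0 then 0 else expR (- t^-1).

(* \int_0^b f, for b >= 0; for b < 0 it is 0, which agrees with the oriented
   integral for the (nonnegative-support) integrands used below *)
Definition integral0 (b : R) (f : R -> R) : R :=
  \int[(@lebesgue_measure R)]_(x in `[0%R, b]) f x.

Definition bumpf (x : R) : R := ell (3 * x) * ell (3 - 3 * x).
Definition alpha0 : R := integral0 1 bumpf.
Definition lam (t : R) : R := alpha0^-1 * integral0 t bumpf.
Definition phi (t : R) : R := integral0 (2^-1 + t) lam.

Definition enorm (n : nat) (u : 'rV[R]_n) : R :=
  Num.sqrt (\sum_(i < n) u ord0 i ^+ 2).

Definition Disk (n m : nat) : set ('rV[R]_n * 'rV[R]_m) :=
  [set p | 1 - phi (2 - enorm p.1 - enorm p.2) <= enorm p.1].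

Definition Sph (n m : nat) : set ('rV[R]_n * 'rV[R]_m) :=
  [set p | 1 <= enorm p.1].
Arguments Disk n m : clear implicits.
Arguments Sph n m : clear implicits.

(** * Fat CW complexes.  skel n stands for X^(n-1); so skel 0 = X^(-1) = empty.
    Cells of dimension n are indexed by cells n; the attaching map att n j
    goes from S^{n-1, cdim j} into X^(n-1) = skel n, the characteristic map
    chr n j from D^{n, cdim j} into X^(n) = skel n.+1. *)

Record fatCW (X : dspace) := FatCW {
  skel : nat -> set X;
  skel0 : skel 0 = set0;
  skelS : forall n, skel n `<=` skel n.+1;
  cells : nat -> Type;
  cdim : forall n, cells n -> nat;
  att : forall n (j : cells n), {s | Sph n (cdim j) s} -> {x | skel n x};
  chr : forall n (j : cells n), {d | Disk n (cdim j) d} -> {x | skel n.+1 x};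
  att_smooth : forall n (j : cells n),
    @smooth_from_esub n (cdim j) (Sph n (cdim j)) X (fun s : {s | Sph n (cdim j) s} => (proj1_sig (att s) : X));
  chr_smooth : forall n (j : cells n),
    @smooth_from_esub n (cdim j) (Disk n (cdim j)) X (fun d : {d | Disk n (cdim j) d} => (proj1_sig (chr d) : X));
  chr_att : forall n (j : cells n) s (hs : Sph n (cdim j) s) (hd : Disk n (cdim j) s),
    proj1_sig (chr (exist _ s hd)) = proj1_sig (att (exist _ s hs));
  (* X^(n) is the pushout of  coprod S -> coprod D  and  h_n : coprod S -> X^(n-1);
     maps out of the coproducts are given componentwise *)
  pushout : forall n (Z : dspace) (g : {x | skel n x} -> Z)
      (f : forall j : cells n, {d | Disk n (cdim j) d} -> Z),
    smooth_from_sub g -> (forall j, smooth_from_esub (f j)) ->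
    (forall j s (hs : Sph n (cdim j) s) (hd : Disk n (cdim j) s),
        f j (exist _ s hd) = g (att (exist _ s hs))) ->
    exists u : {x | skel n.+1 x} -> Z,
      [/\ smooth_from_sub u,
          (forall x : {x | skel n x},
              u (exist _ (proj1_sig x) (@skelS n _ (proj2_sig x))) = g x),
          (forall j d, u (@chr n j d) = f j d) &
          (forall u' : {x | skel n.+1 x} -> Z, smooth_from_sub u' ->
             (forall x : {x | skel n x},
                 u' (exist _ (proj1_sig x) (@skelS n _ (proj2_sig x))) = g x) ->
             (forall j d, u' (@chr n j d) = f j d) ->
             forall y, u' y = u y)];
  colim : forall (Z : dspace) (g : forall n, {x | skel n x} -> Z),
    (forall n, smooth_from_sub (g n)) ->
    (forall n (x : {x | skel n x}),
        g n.+1 (exist _ (proj1_sig x) (@skelS n _ (proj2_sig x))) = g n x) ->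
    exists u : X -> Z,
      [/\ dsmooth u,
          (forall n (x : {x | skel n x}), u (proj1_sig x) = g n x) &
          (forall u' : X -> Z, dsmooth u' ->
             (forall n (x : {x | skel n x}), u' (proj1_sig x) = g n x) ->
             forall y, u' y = u y)]
}.

(* regular: each h_n : coprod_j S^{n-1,m_n(j)} -> X^(n-1) is an induction
   with D-open image in X^(n-1) *)
Definition regularCW (X : dspace) (C : fatCW X) : Prop :=
  forall n : nat,
  [/\
      (forall (j1 j2 : cells C n) (s1 : {s | Sph n (cdim j1) s})
              (s2 : {s | Sph n (cdim j2) s}),
         proj1_sig (att s1) = proj1_sig (att s2) ->
         existT (fun j => {s | Sph n (cdim j) s}) j1 s1 = existT _ j2 s2),
      (* induction: every plot of X with values in the image is locally
         h_n composed with a plot of the coproduct of the spheres *)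
      (forall k (U : set 'rV[R]_k) (Q : {x | U x} -> X), dplot Q ->
         (forall x, exists (j : cells C n) (s : {s | Sph n (cdim j) s}),
            Q x = proj1_sig (att s)) ->
         forall x : {x | U x},
         exists (V : set 'rV[R]_k) (hVU : V `<=` U) (j : cells C n)
                (P : {y | V y} -> 'rV[R]_n * 'rV[R]_(cdim j))
                (hS : forall y, Sph n (cdim j) (P y)),
           [/\ open V, V (proj1_sig x), eplot P &
               forall y, proj1_sig (att (exist _ (P y) (hS y))) = prestr hVU Q y]) &
      D_open_in (skel C n)
        [set x : X | exists (j : cells C n) (s : {s | Sph n (cdim j) s}),
           x = proj1_sig (att s)]].

End Diffeology.

(* Main.v *)
(* A preplot P is handled by induction on the skeleta. Near a point sent into the
   image of a characteristic map, multiplying the coordinates of D^{n,m} by a bump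
   function gives smooth functions on X^(n) that exhibit P locally as a smooth map
   into the cell; the bump function extends by zero because the attaching map has
   D-open image, compact sets of the sphere region have closed image, and smooth
   functions separate points. Near any other point P stays in X^(n-1), where it is
   again a preplot, because every smooth function on X^(n-1) extends to X^(n).

   That extension property amounts to extending functions g that are smooth on
   S^{n-1,m} for the subset diffeology. In half space coordinates this is Seeley's
   theorem: E(-s, y) = sum_k a_k g(8^k s, y) with sum_k a_k (-8^k)^i = 1 for all i.
   The normal derivative of g, up to the boundary, is half the second derivative of
   z |-> g(t + z^2, y) at 0, so that it is again smooth for the subset diffeology. *)
Require Import Defs.
From HB Require Import structures.
From mathcomp Require Import all_boot all_order all_algebra.
From mathcomp Require Import all_classical all_reals all_analysis.
From mathcomp Require Import ring lra.
Set Implicit Arguments.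
Unset Strict Implicit.
Unset Printing Implicit Defensive.
Import Order.TTheory GRing.Theory Num.Theory.
Import numFieldNormedType.Exports.
Local Open Scope classical_set_scope.
Local Open Scope ring_scope.

(** * Smooth functions on open sets of row vectors *)

Section SmoothCalculus.
Variable R : realType.

(** Three obstacles shape the proof. The pushout X^(n) is given only by its universal property, so
    its plots are not known to lift; mapping into an explicit model recovers local lifts through
    X^(n-1) or one cell, and mapping into an indiscrete space recovers the underlying set. Extending
    a bump by zero from a sphere to X^(n-1) needs a compact image to be closed, yet the D-topology
    is not known to be Hausdorff; separation of points by smooth functions replaces this and is
    carried through the induction. Finally, J_n may be infinite, so values in infinitely many cells
    might accumulate at a point outside all of them; a function scaled independently on each cell
    excludes this. In the regularity condition, injectivity of h_n makes a transported bump well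
    defined, D-openness makes its smoothness on the image a local matter, and the induction property
    supplies lifts to a single sphere. *)

Lemma near_eq_continuous_at (T U : topologicalType) (f g : T -> U) (x : T) :
  (\near x, f x = g x) -> {for x, continuous f} -> {for x, continuous g}.
Proof.
move=> fg; rewrite /prop_for /continuous_at (nbhs_singleton fg) => cf.
exact: cvg_trans (near_eq_cvg fg) cf.
Qed.

Lemma ideriv_near k (V : normedModType R) (f g : 'rV[R]_k -> V) vs (x : 'rV[R]_k) :
  (\near x, f x = g x) -> \near x, ideriv vs f x = ideriv vs g x.
Proof.
move=> fg; elim: vs => [//|v vs IH] /=.
by have := near_join IH; apply: filterS => y /near_eq_derive; exact.
Qed.

Lemma smooth_on_near k (V : normedModType R) (U : set 'rV[R]_k)
    (f : 'rV[R]_k -> V) :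
  (forall x, U x -> exists2 g, smooth_on U g & \near x, g x = f x) ->
  smooth_on U f.
Proof.
move=> H vs x Ux; have [g sg gf] := H x Ux.
have [cg dg] := sg vs x Ux.
have e := ideriv_near vs gf.
by split=> [|v]; [exact: near_eq_continuous_at e cg|exact: near_eq_derivable (dg v)].
Qed.

Lemma smooth_on_sub k (V : normedModType R) (U U' : set 'rV[R]_k)
    (f : 'rV[R]_k -> V) : U' `<=` U -> smooth_on U f -> smooth_on U' f.
Proof. by move=> sU sf vs x /sU; exact: sf. Qed.

Lemma smooth_on_local k (V : normedModType R) (U : set 'rV[R]_k)
    (f : 'rV[R]_k -> V) :
  (forall x, U x -> exists g (U' : set 'rV[R]_k),
     [/\ open U', U' x, (forall y, U' y -> f y = g y) & smooth_on U' g]) ->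
  smooth_on U f.
Proof.
move=> H vs x Ux; have [g [U' [oU' U'x fg sg]]] := H x Ux.
suff : smooth_on U' f by exact.
apply: smooth_on_near => y U'y; exists g => //.
by near=> z; rewrite fg//; near: z; exact: open_nbhs_nbhs.
Unshelve. all: by end_near. Qed.

Lemma eq_smooth_on k (V : normedModType R) (U : set 'rV[R]_k)
    (f g : 'rV[R]_k -> V) : open U ->
  (forall x, U x -> f x = g x) -> smooth_on U f -> smooth_on U g.
Proof.
move=> oU fg sf; apply: smooth_on_local => x Ux; exists f, U; split=> // y Uy.
by rewrite fg.
Qed.

Lemma smooth_on_continuous k (V : normedModType R) (U : set 'rV[R]_k)
    (f : 'rV[R]_k -> V) : smooth_on U f ->
  forall x, U x -> {for x, continuous f}.
Proof. by move=> sf x Ux; have [] := sf [::] x Ux. Qed.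

Lemma smooth_on_is_derive k (V : normedModType R) (U : set 'rV[R]_k)
    (f : 'rV[R]_k -> V) v : smooth_on U f ->
  forall x, U x -> is_derive x v f ('D_v f x).
Proof. by move=> sf x Ux; have [_ /(_ v)/derivableP] := sf [::] x Ux. Qed.

Lemma smooth_on_derivable k (V : normedModType R) (U : set 'rV[R]_k)
    (f : 'rV[R]_k -> V) : smooth_on U f ->
  forall x v, U x -> derivable f x v.
Proof. by move=> sf x v Ux; have [_ /(_ v)] := sf [::] x Ux. Qed.

Lemma smooth_on_derive k (V : normedModType R) (U : set 'rV[R]_k)
    (f : 'rV[R]_k -> V) v : smooth_on U f -> smooth_on U ('D_v f).
Proof.
move=> sf vs x Ux; have := sf (rcons vs v) x Ux.
suff -> : ideriv (rcons vs v) f = ideriv vs ('D_v f) by [].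
by elim: vs => [//|w vs /= ->].
Qed.

(* Smoothness is proved throughout by exhibiting a class of continuous
   functions that is stable under directional derivatives. *)
Lemma smooth_on_class k (V : normedModType R) (U : set 'rV[R]_k)
    (C : ('rV[R]_k -> V) -> Prop) : open U ->
  (forall f, C f -> forall x, U x -> {for x, continuous f}) ->
  (forall f, C f -> forall v,
     exists2 f', C f' & forall x, U x -> is_derive x v f (f' x)) ->
  forall f, C f -> smooth_on U f.
Proof.
move=> oU cC dC f Cf.
have H vs : exists2 f', C f' & forall x, U x -> f' x = ideriv vs f x.
  elim: vs => [|v vs [f' Cf' ff']] /=; first by exists f.
  have [f'' Cf'' df'] := dC _ Cf' v; exists f'' => // x Ux.
  rewrite -(@near_eq_derive _ _ _ f') ?(@derive_val _ _ _ _ _ _ _ (df' x Ux))//.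
  by near=> y; apply: ff'; near: y; exact: open_nbhs_nbhs.
move=> vs x Ux; have [f' Cf' ff'] := H vs.
have e : \near x, f' x = ideriv vs f x.
  by near=> y; apply: ff'; near: y; exact: open_nbhs_nbhs.
split=> [|v]; first exact: near_eq_continuous_at e (cC _ Cf' x Ux).
have [f'' _ df'] := dC _ Cf' v.
apply: (near_eq_derivable e); exact: (@ex_derive _ _ _ _ _ _ _ (df' x Ux)).
Unshelve. all: by end_near. Qed.

#[local] Opaque smooth_on ideriv.

Lemma smooth_on_cst k (V : normedModType R) (U : set 'rV[R]_k) (c : V) :
  open U -> smooth_on U (fun _ => c).
Proof.
move=> oU; apply: (@smooth_on_class _ _ _ (fun f => exists c, f = cst c)) => //.
- by move=> _ [d ->] x _; exact: cst_continuous.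
- by move=> _ [d ->] v; exists (cst 0); [exists 0|move=> x _; exact: is_derive_cst].
- by exists c.
Qed.

Lemma smooth_on_coord k (U : set 'rV[R]_k) (i : 'I_k) :
  open U -> smooth_on U (fun x : 'rV[R]_k => x ord0 i).
Proof.
move=> oU; apply: (@smooth_on_class _ _ _ (fun f => (exists c, f = cst c) \/
  f = (fun x : 'rV[R]_k => x ord0 i))) => //; last by right.
- by move=> _ [[d ->]|->] x _; [exact: cst_continuous|exact: coord_continuous].
- move=> _ [[d ->]|->] v.
    by exists (cst 0); [left; exists 0|move=> x _; exact: is_derive_cst].
  exists (cst (v ord0 i)); [by left; exists (v ord0 i)|move=> x _].
  have dx := @is_derive_id _ _ x v.
  have dd := @ex_derive _ _ _ _ _ _ _ dx.
  have /derivable_mxP /(_ ord0 i) d := dd.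
  split=> //.
  by have := derive_mx dd; rewrite derive_id => /matrixP /(_ ord0 i); rewrite mxE.
Qed.

Lemma smooth_onD k (V : normedModType R) (U : set 'rV[R]_k)
    (f g : 'rV[R]_k -> V) : open U ->
  smooth_on U f -> smooth_on U g -> smooth_on U (fun x => f x + g x).
Proof.
move=> oU sf sg; apply: (@smooth_on_class _ _ _ (fun h => exists f g,
   [/\ smooth_on U f, smooth_on U g & h = f + g])) => //; last by exists f, g.
- move=> _ [f1 [g1 [sf1 sg1 ->]]] x Ux.
  by apply: continuousD; [exact: (smooth_on_continuous sf1 Ux)|exact: (smooth_on_continuous sg1 Ux)].
- move=> _ [f1 [g1 [sf1 sg1 ->]]] v; exists ('D_v f1 + 'D_v g1).
    by exists ('D_v f1), ('D_v g1); split; [exact: smooth_on_derive|exact: smooth_on_derive|].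
  by move=> x Ux; exact: (is_deriveD (smooth_on_is_derive v sf1 Ux) (smooth_on_is_derive v sg1 Ux)).
Qed.

(** Products alone are not stable under derivatives: the Leibniz rule produces a sum of two
    products, hence the closure under sums. *)
Inductive prod_class k (U : set 'rV[R]_k) : ('rV[R]_k -> R) -> Prop :=
| prod_base (f g : 'rV[R]_k -> R) : smooth_on U f -> smooth_on U g -> prod_class U (f * g)
| prod_add (f g : 'rV[R]_k -> R) : prod_class U f -> prod_class U g -> prod_class U (f + g).

Lemma smooth_onM k (U : set 'rV[R]_k) (f g : 'rV[R]_k -> R) : open U ->
  smooth_on U f -> smooth_on U g -> smooth_on U (fun x => f x * g x).
Proof.
move=> oU sf sg; apply: (@smooth_on_class _ _ _ (@prod_class k U)) => //.
- move=> h Ch x Ux; elim: Ch => [f1 g1 sf1 sg1|f1 g1 _ c1 _ c2].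
    by apply: continuousM; [exact: (smooth_on_continuous sf1 Ux)|exact: (smooth_on_continuous sg1 Ux)].
  exact: continuousD c1 c2.
- move=> h Ch v; elim: Ch => [f1 g1 sf1 sg1|f1 g1 _ [f1' Cf1 df1] _ [g1' Cg1 dg1]].
    exists (f1 * 'D_v g1 + g1 * 'D_v f1).
      apply: prod_add; apply: prod_base;
        [exact: sf1|exact: smooth_on_derive|exact: sg1|exact: smooth_on_derive].
    by move=> x Ux; exact: (is_deriveM (smooth_on_is_derive v sf1 Ux) (smooth_on_is_derive v sg1 Ux)).
  exists (f1' + g1'); first exact: prod_add.
  by move=> x Ux; exact: (is_deriveD (df1 x Ux) (dg1 x Ux)).
- exact: (prod_base sf sg).
Qed.

Lemma smooth_onN k (U : set 'rV[R]_k) (f : 'rV[R]_k -> R) : open U ->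
  smooth_on U f -> smooth_on U (fun x => - f x).
Proof.
move=> oU sf; apply: (@eq_smooth_on _ _ _ (fun x => (-1) * f x)); first exact: oU.
  by move=> x _; rewrite mulN1r.
by apply: smooth_onM; [exact: oU|exact: smooth_on_cst|exact: sf].
Qed.

Lemma smooth_onB k (U : set 'rV[R]_k) (f g : 'rV[R]_k -> R) : open U ->
  smooth_on U f -> smooth_on U g -> smooth_on U (fun x => f x - g x).
Proof.
by move=> oU sf sg; apply: smooth_onD; [exact: oU|exact: sf|exact: smooth_onN].
Qed.

Lemma smooth_on_sum k (U : set 'rV[R]_k) I (s : seq I) (f : I -> 'rV[R]_k -> R) :
  open U -> (forall i, smooth_on U (f i)) ->
  smooth_on U (fun x => \sum_(i <- s) f i x).
Proof.
move=> oU sf; elim: s => [|i s IH].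
  apply: (@eq_smooth_on _ _ _ (fun=> 0)) => [//||]; last exact: smooth_on_cst.
  by move=> x _; rewrite big_nil.
apply: (@eq_smooth_on _ _ _ (fun x => f i x + \sum_(i <- s) f i x)); first exact: oU.
  by move=> x _; rewrite big_cons.
by apply: smooth_onD; [exact: oU|exact: sf|exact: IH].
Qed.

Lemma smooth_onX k (U : set 'rV[R]_k) (f : 'rV[R]_k -> R) n : open U ->
  smooth_on U f -> smooth_on U (fun x => f x ^+ n).
Proof.
move=> oU sf; elim: n => [|n IH].
  have -> : (fun x => f x ^+ 0) = (fun=> 1) by apply/funext => x; rewrite expr0.
  exact: smooth_on_cst.
have -> : (fun x => f x ^+ n.+1) = (fun x => f x * f x ^+ n).
  by apply/funext => x; rewrite exprS.
exact: smooth_onM.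
Qed.

Lemma mx_continuousP (T : topologicalType) m n (F : T -> 'M[R]_(m, n)) x :
  (forall i j, {for x, continuous (fun y => F y i j)}) -> {for x, continuous F}.
Proof.
move=> cF; apply/cvgrPdist_le => /= e e0; near=> y.
rewrite /Num.Def.normr/= mx_normrE (bigmax_le _ (ltW e0))//= => i _.
rewrite !mxE; move: i; near: y; apply: filter_forall => /= i.
by have /cvgrPdist_le /(_ _ e0) := cF i.1 i.2.
Unshelve. all: by end_near. Qed.

Lemma is_derive_mx k m n (F : 'rV[R]_k -> 'M[R]_(m, n)) x v
    (dF : 'M[R]_(m, n)) :
  (forall i j, is_derive x v (fun y => F y i j) (dF i j)) -> is_derive x v F dF.
Proof.
move=> dx; have dFx : derivable F x v.
  by apply/derivable_mxP => i j; exact: (@ex_derive _ _ _ _ _ _ _ (dx i j)).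
split=> //; rewrite derive_mx//; apply/matrixP => i j; rewrite mxE.
exact: (@derive_val _ _ _ _ _ _ _ (dx i j)).
Qed.

Lemma smooth_on_rV k (U : set 'rV[R]_k) n (F : 'rV[R]_k -> 'rV[R]_n) :
  open U -> (forall i, smooth_on U (fun x => F x ord0 i)) -> smooth_on U F.
Proof.
move=> oU sF; apply: (@smooth_on_class _ _ _
  (fun F : 'rV[R]_k -> 'rV[R]_n => forall i, smooth_on U (fun x => F x ord0 i))) => //.
- move=> G sG x Ux; apply: mx_continuousP => i j; rewrite ord1.
  exact: (smooth_on_continuous (sG j) Ux).
- move=> G sG v; exists (fun x => \row_i 'D_v (fun x => G x ord0 i) x) => [i|].
    apply: (@eq_smooth_on _ _ _ ('D_v (fun x => G x ord0 i))) => //.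
      by move=> x _; rewrite mxE.
    exact: smooth_on_derive.
  move=> x Ux; apply: is_derive_mx => i j; rewrite ord1 mxE.
  exact: (smooth_on_is_derive v (sG j) Ux).
Qed.

Lemma rV_smooth_on k (U : set 'rV[R]_k) n (F : 'rV[R]_k -> 'rV[R]_n) i :
  open U -> smooth_on U F -> smooth_on U (fun x => F x ord0 i).
Proof.
move=> oU sF.
apply: (@smooth_on_class _ _ _ (fun f => exists2 G : 'rV[R]_k -> 'rV[R]_n,
   smooth_on U G & f = fun x => G x ord0 i)) => //; last by exists F.
- move=> _ [G sG ->] x Ux.
  apply: (@continuous_comp _ _ _ G (fun y : 'rV[R]_n => y ord0 i)).
    exact: (smooth_on_continuous sG Ux).
  exact: coord_continuous.
- move=> _ [G sG ->] v; exists (fun x => 'D_v G x ord0 i).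
    by exists ('D_v G); first exact: smooth_on_derive.
  move=> x Ux; have dG := @ex_derive _ _ _ _ _ _ _ (smooth_on_is_derive v sG Ux).
  have /derivable_mxP/(_ ord0 i) d := dG.
  by split=> //; rewrite derive_mx// mxE.
Qed.

End SmoothCalculus.

#[local] Opaque smooth_on ideriv.

(** * Total differentiability and the chain rule *)

Section ChainRule.
Variable R : realType.

Lemma is_derive_line k (V : normedModType R) (f : 'rV[R]_k -> V) (x v : 'rV[R]_k) (t : R) l :
  is_derive (x + t *: v) v f l <-> is_derive t 1 (fun s : R => f (x + s *: v)) l.
Proof.
have e : (fun h : R => h^-1 *: (((fun s : R => f (x + s *: v)) \o shift t) (h *: 1)
            - f (x + t *: v))) =
    (fun h => h^-1 *: ((f \o shift (x + t *: v)) (h *: v) - f (x + t *: v))).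
  apply/funext => h /=; rewrite [h%:A]mulr1 scalerDl.
  by rewrite [x + (h *: v + _)]addrCA.
by split; case=> d <-; split; move: d; rewrite /derivable /derive e.
Qed.

Lemma is_derive_scale k (f : 'rV[R]_k -> R) (x v : 'rV[R]_k) l c :
  is_derive x v f l -> is_derive x (c *: v) f (c * l).
Proof.
move=> d; have {}d : is_derive (x + (c * 0) *: v) v f l by rewrite mulr0 scale0r addr0.
rewrite -[x]addr0 -[X in x + X](scale0r (c *: v)); apply/is_derive_line.
have -> : (fun s : R => f (x + s *: (c *: v))) =
    (fun s : R => f (x + s *: v)) \o (fun s => c * s).
  by apply/funext => s /=; rewrite scalerA mulrC.
rewrite mulrC; apply: is_derive1_comp; first exact/is_derive_line.
have := is_deriveZ c (is_derive_id (0 : R) (1 : R)).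
by rewrite [_ *: 1]mulr1.
Qed.

Lemma line_MVT k (f df : 'rV[R]_k -> R) (x v : 'rV[R]_k) :
  (forall t : R, 0 <= t <= 1 -> is_derive (x + t *: v) v f (df (x + t *: v))) ->
  exists2 t : R, 0 <= t <= 1 & f (x + v) - f x = df (x + t *: v).
Proof.
move=> H.
have D (t : R) : 0 <= t <= 1 -> is_derive t 1 (fun s : R => f (x + s *: v)) (df (x + t *: v)).
  by move=> t01; apply/is_derive_line; exact: H.
have [|||c] := @MVT_segment R (fun s : R => f (x + s *: v))
  (fun s => df (x + s *: v)) 0 1.
- exact: ler01.
- by move=> t; rewrite in_itv /= => /andP[t0 t1]; apply: D; rewrite !ltW.
- apply: derivable_within_continuous => t; rewrite in_itv /= => /D dt.
  exact: ex_derive.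
by rewrite in_itv /= scale1r scale0r addr0 subr0 mulr1; exists c.
Qed.

Lemma norm_delta_mx k (i : 'I_k) : `|delta_mx ord0 i : 'rV[R]_k| <= 1.
Proof.
rewrite /Num.Def.normr/= mx_normrE (bigmax_le _ ler01)//= => j _.
by rewrite mxE; case: (_ && _); rewrite ?normr1 ?normr0 ?ler01.
Qed.

Lemma norm_coord k (v : 'rV[R]_k) i : `|v ord0 i| <= `|v|.
Proof.
by rewrite [leRHS]/Num.Def.normr/= mx_normrE; apply: (le_bigmax _ _ (ord0, i)).
Qed.

(** Go from [a] to [a + d] along one coordinate axis at a time and apply the mean value theorem on
    each leg; a leg costs an error of at most [e / k.+1] times the norm of [d], and there are [k]
    legs. *)
Lemma C1_increment k (f : 'rV[R]_k -> R) (a : 'rV[R]_k) (U : set 'rV[R]_k) : open U -> U a ->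
  (forall x v : 'rV[R]_k, U x -> derivable f x v) ->
  (forall i : 'I_k, {for a, continuous ('D_(delta_mx ord0 i) f)}) ->
  forall e, 0 < e -> \forall d \near (0 : 'rV[R]_k),
    `|f (a + d) - f a - \sum_i d ord0 i * 'D_(delta_mx ord0 i) f a| <= e * `|d|.
Proof.
move=> oU Ua df cf e e0.
have e1 : 0 < e / k.+1%:R by rewrite divr_gt0.
have : \forall y \near a, U y /\ forall i : 'I_k,
    `|'D_(delta_mx ord0 i) f y - 'D_(delta_mx ord0 i) f a| <= e / k.+1%:R.
  near=> y; split; first by near: y; exact: open_nbhs_nbhs.
  near: y; apply: filter_forall => i /=.
  by have /cvgr_distC_le := cf i; exact.
move=> /nbhs_ballP [r /= r0 rP].
(* A point of the path is at most [k] times the norm of [d] away from [a], so this radius for [d]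
   keeps the whole path in the ball. *)
have r1 : 0 < r / k.+1%:R by rewrite divr_gt0.
apply: filterS (@nbhs0_lt _ 'rV[R]_k _ r1) => d dr.
pose p s := a + \sum_(i <- s) d ord0 i *: (delta_mx ord0 i : 'rV[R]_k).
have near_p s (t : R) i : (size s < k.+1)%N -> 0 <= t <= 1 ->
    (size (i :: s) < k.+1)%N ->
    ball a r (p s + t *: (d ord0 i *: (delta_mx ord0 i : 'rV[R]_k))).
  move=> _ /andP[t0 t1] ss.
  rewrite -ball_normE /ball_ /= /p opprD addrA opprD addrA subrr sub0r.
  rewrite -opprD normrN.
  have H1 : `|\sum_(j <- s) d ord0 j *: (delta_mx ord0 j : 'rV[R]_k)| <=
      (size s)%:R * `|d|.
    elim: {ss} s => [|j s IH]; first by rewrite big_nil normr0 mul0r.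
    rewrite big_cons /= -natr1 mulrDl mul1r addrC (le_trans (ler_normD _ _))//.
    rewrite lerD// normrZ -[leRHS]mulr1 ler_pM// ?norm_coord// norm_delta_mx//.
  have H2 : `|t *: (d ord0 i *: (delta_mx ord0 i : 'rV[R]_k))| <= `|d|.
    rewrite !normrZ (ger0_norm t0) -[leRHS]mul1r ler_pM// -[leRHS]mulr1 ler_pM//.
      exact: norm_coord.
    exact: norm_delta_mx.
  rewrite (le_lt_trans (ler_normD _ _))// (le_lt_trans (lerD H1 H2))//.
  rewrite -[X in _ + X]mul1r -mulrDl natr1.
  have := dr; rewrite ltr_pdivlMr// mulrC; apply: le_lt_trans.
  by rewrite ler_wpM2r// ler_nat; exact: ltnW ss.
have main s : (size s < k.+1)%N ->
    `|f (p s) - f a - \sum_(i <- s) d ord0 i * 'D_(delta_mx ord0 i) f a| <=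
      (size s)%:R * (e / k.+1%:R * `|d|).
  elim: s => [_|i s IH ss].
    by rewrite /p !big_nil addr0 subrr subr0 normr0 mul0r.
  have {}IH := IH (ltnW ss).
  have pE : p (i :: s) = p s + d ord0 i *: (delta_mx ord0 i : 'rV[R]_k).
    by rewrite /p big_cons addrCA addrC.
  have [|t t01 E] := @line_MVT k f
     (fun y => d ord0 i * 'D_(delta_mx ord0 i) f y) (p s)
     (d ord0 i *: delta_mx ord0 i).
    move=> t t01; have [Uy _] := rP _ (near_p s t i (ltnW ss) t01 ss).
    by apply: is_derive_scale; apply/derivableP; exact: df.
  have [_ /(_ i) dd] := rP _ (near_p s t i (ltnW ss) t01 ss).
  rewrite pE big_cons.
  rewrite (_ : _ - _ - _ = (f (p s) - f a - \sum_(j <- s) d ord0 j * 'D_(delta_mx ord0 j) f a)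
    + d ord0 i * ('D_(delta_mx ord0 i) f (p s + t *: (d ord0 i *: delta_mx ord0 i))
        - 'D_(delta_mx ord0 i) f a)); last first.
    by rewrite mulrBr -E; ring.
  have -> : (size (i :: s))%:R = (size s)%:R + 1 :> R by rewrite natr1.
  rewrite (le_trans (ler_normD _ _))// mulrDl mul1r lerD//.
  by rewrite normrM mulrC ler_pM// norm_coord.
have := main (index_enum 'I_k).
rewrite -[X in (size X < _)%N]enumT size_enum_ord ltnS leqnn => /(_ isT).
have -> : p (index_enum 'I_k) = a + d.
  by rewrite /p [in RHS](row_sum_delta d).
move=> /le_trans; apply.
rewrite -[X in (size X)%:R]enumT size_enum_ord mulrA ler_wpM2r// mulrC -mulrA.
by rewrite ger_pMr// ler_pdivrMl// mulr1 ler_nat.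
Unshelve. all: by end_near. Qed.

(** [smooth_on] only speaks of directional derivatives. The estimate [C1_increment] turns the
    partials into a total differential, which the chain rule requires. *)
Lemma smooth_on_differentiable k (U : set 'rV[R]_k) (f : 'rV[R]_k -> R) a :
  open U -> smooth_on U f -> U a ->
  differentiable f a /\
  forall v, 'D_v f a = \sum_i v ord0 i * 'D_(delta_mx ord0 i) f a.
Proof.
move=> oU sf Ua.
pose df (v : 'rV[R]_k) := \sum_i v ord0 i * 'D_(delta_mx ord0 i) f a.
have lin_df : linear df.
  move=> c u v; rewrite /df scaler_sumr -big_split /=; apply: eq_bigr => i _.
  by rewrite !mxE mulrDl -mulrA.
pose dfM := GRing.isLinear.Build _ _ _ _ _ lin_df.
pose dfL : {linear 'rV[R]_k -> R} := HB.pack df dfM.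
have cdf : continuous dfL.
  have s : smooth_on setT df.
    apply: smooth_on_sum => [|i]; first exact: openT.
    apply: smooth_onM; [exact: openT|apply: smooth_on_coord|apply: smooth_on_cst];
      exact: openT.
  by move=> x; exact: (smooth_on_continuous s (I : setT x)).
have H : f \o shift a = cst (f a) + dfL +o_ (0 : 'rV[R]_k) id.
  apply/eqaddoP => _/posnumP[e].
  have := @C1_increment k f a U oU Ua _ _ e%:num [gt0 of e%:num].
  move=> /(_ (smooth_on_derivable sf)).
  move=> /(_ (fun i => smooth_on_continuous (smooth_on_derive _ sf) Ua)).
  apply: filterS => d /=; rewrite -[X in _ <= X -> _]/(e%:num * `|id d|).
  by rewrite !fctE /= opprD addrA [d + a]addrC.
have dE := diff_unique cdf H.
have D : differentiable f a by apply/diff_locallyP; rewrite dE.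
by split=> // v; rewrite deriveE// dE.
Qed.

(** Only the derivative of [F] along [v] is given, so [F] is restricted to a line through [x]: for a
    curve, derivability is differentiability, and the two differentials compose. *)
Lemma is_derive_chain k k' (f : 'rV[R]_k -> R) (F : 'rV[R]_k' -> 'rV[R]_k) (x v : 'rV[R]_k') dF :
  differentiable f (F x) -> is_derive x v F dF ->
  is_derive x v (f \o F) ('D_dF f (F x)).
Proof.
move=> df [dFx <-].
have d1 : derivable (fun h : R => F (h *: v + x)) (0 : R) (1 : R).
  exact: (derivable1P F x v).1 dFx.
have d2 := (derivable1_diffP (fun h : R => F (h *: v + x)) 0).1 d1.
have F0 : F ((0 : R) *: v + x) = F x by rewrite scale0r add0r.
have df0 : differentiable f (F ((0 : R) *: v + x)) by rewrite F0.
have d3 := differentiable_comp d2 df0.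
pose c (h : R) := F (h *: v + x).
have E (g : 'rV[R]_k -> R) : (fun h : R => h^-1 *: (((g \o F) \o shift x) (h *: v) - (g \o F) x)) =
    (fun h : R => h^-1 *: (((g \o c) \o shift 0) (h *: 1) - (g \o c) 0)).
  by apply/funext => h; rewrite /c /= addr0 F0 [h%:A]mulr1.
have E' : (fun h : R => h^-1 *: ((F \o shift x) (h *: v) - F x)) =
    (fun h : R => h^-1 *: ((c \o shift 0) (h *: 1) - c 0)).
  by apply/funext => h; rewrite /c /= addr0 F0 [h%:A]mulr1.
have d4 : derivable (f \o c) 0 1 by exact: diff_derivable d3.
split; first by rewrite /derivable E.
rewrite /derive E -/(derive (f \o c) 0 1) deriveE//.
rewrite (diff_comp d2 df0) /= [in X in 'd f X]F0.
rewrite -(deriveE _ d2) -[RHS]/('D_('D_v F x) f (F x)) (deriveE _ df); congr ('d f _ _).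
by rewrite /derive E'.
Qed.

(** Differentiating [f \o F] gives partials of [f] composed with [F], weighted by derivatives of the
    coordinates of [F]; the factor [p] collects these weights. *)
Inductive chain_class k k' (U : set 'rV[R]_k) (V : set 'rV[R]_k')
    (F : 'rV[R]_k' -> 'rV[R]_k) : ('rV[R]_k' -> R) -> Prop :=
| chain_base (p : 'rV[R]_k' -> R) (f : 'rV[R]_k -> R) :
    smooth_on V p -> smooth_on U f -> chain_class U V F (p * (f \o F))
| chain_add (f g : 'rV[R]_k' -> R) :
    chain_class U V F f -> chain_class U V F g -> chain_class U V F (f + g).

Lemma chain_sum k k' (U : set 'rV[R]_k) (V : set 'rV[R]_k')
    (F : 'rV[R]_k' -> 'rV[R]_k) I (s : seq I) (p : I -> 'rV[R]_k' -> R)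
    (f : I -> 'rV[R]_k -> R) : open U -> open V ->
  (forall i, smooth_on V (p i)) -> (forall i, smooth_on U (f i)) ->
  chain_class U V F (fun x => \sum_(i <- s) p i x * f i (F x)).
Proof.
move=> oU oV sp sf; elim: s => [|i s IH].
  have -> : (fun x => \sum_(i <- [::]) p i x * f i (F x)) =
      (fun _ : 'rV[R]_k' => 0 : R) * ((fun _ : 'rV[R]_k => 0 : R) \o F).
    by apply/funext => x; rewrite big_nil /= mulr0.
  by apply: chain_base; apply: smooth_on_cst.
have -> : (fun x => \sum_(j <- i :: s) p j x * f j (F x)) =
    p i * (f i \o F) + (fun x => \sum_(i <- s) p i x * f i (F x)).
  by apply/funext => x; rewrite big_cons.
by apply: chain_add IH; apply: chain_base; [exact: sp|exact: sf].
Qed.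

Lemma smooth_on_comp_real k k' (U : set 'rV[R]_k) (V : set 'rV[R]_k')
    (f : 'rV[R]_k -> R) (F : 'rV[R]_k' -> 'rV[R]_k) : open U -> open V ->
  (forall x, V x -> U (F x)) -> smooth_on U f -> smooth_on V F ->
  smooth_on V (f \o F).
Proof.
move=> oU oV VU sf sF.
have sFi i : smooth_on V (fun x => F x ord0 i) by exact: rV_smooth_on.
apply: (@smooth_on_class _ _ _ _ (chain_class U V F) oV).
- move=> h Ch x Vx; elim: Ch => [p g sp sg|g1 g2 _ c1 _ c2].
    apply: continuousM; first exact: (smooth_on_continuous sp Vx).
    apply: continuous_comp; first exact: (smooth_on_continuous sF Vx).
    exact: (smooth_on_continuous sg (VU _ Vx)).
  exact: continuousD c1 c2.
- move=> h Ch v; elim: Ch => [p g sp sg|f1 g1 _ [f1' Cf1 df1] _ [g1' Cg1 dg1]].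
    exists ('D_v p * (g \o F) +
       (fun x => \sum_i (p x * 'D_v (fun x => F x ord0 i) x) *
          'D_(delta_mx ord0 i) g (F x))).
      apply: chain_add.
        by apply: chain_base; [exact: smooth_on_derive|exact: sg].
      apply: (@chain_sum _ _ _ _ F _ _ (fun i x => p x * 'D_v (fun x => F x ord0 i) x)
        (fun i => 'D_(delta_mx ord0 i) g) oU oV) => i.
        by apply: smooth_onM; [exact: oV|exact: sp|exact: smooth_on_derive].
      exact: smooth_on_derive.
    move=> x Vx.
    have [dg Dg] := smooth_on_differentiable oU sg (VU _ Vx).
    apply: is_derive_eq.
      apply: is_deriveM; first exact: (smooth_on_is_derive v sp Vx).
      exact: is_derive_chain dg (smooth_on_is_derive v sF Vx).
    rewrite addrC; congr (_ + _); first by rewrite [RHS]mulrC.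
    rewrite Dg scaler_sumr; apply: eq_bigr => i _.
    rewrite [LHS]mulrA; congr (_ * _ * _).
    by rewrite derive_mx ?mxE//; exact: (smooth_on_derivable sF).
  exists (f1' + g1'); first exact: chain_add.
  by move=> x Ux; exact: (is_deriveD (df1 x Ux) (dg1 x Ux)).
have -> : f \o F = (fun=> 1) * (f \o F) by apply/funext => x; rewrite /= mul1r.
by apply: chain_base; [exact: smooth_on_cst|exact: sf].
Qed.

Lemma smooth_on_comp k k' n (U : set 'rV[R]_k) (V : set 'rV[R]_k')
    (f : 'rV[R]_k -> 'rV[R]_n) (F : 'rV[R]_k' -> 'rV[R]_k) : open U -> open V ->
  (forall x, V x -> U (F x)) -> smooth_on U f -> smooth_on V F ->
  smooth_on V (f \o F).
Proof.
move=> oU oV VU sf sF; apply: smooth_on_rV => [|i]; first exact: oV.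
apply: (smooth_on_comp_real (f := fun x => f x ord0 i) oU oV VU _ sF).
exact: rV_smooth_on.
Qed.

End ChainRule.

(** * Inverses, the flat function [ell] and a smooth step *)

Section Outer.
Variable R : realType.

(** The same device for functions of one real variable; in [smooth_on_outer], [D] is a family closed
    under differentiation on a set that contains the values of [f]. *)
Inductive outer_class k (U : set 'rV[R]_k) (D : (R -> R) -> Prop)
    (f : 'rV[R]_k -> R) : ('rV[R]_k -> R) -> Prop :=
| outer_base (p : 'rV[R]_k -> R) (h : R -> R) :
    smooth_on U p -> D h -> outer_class U D f (p * (h \o f))
| outer_add (g h : 'rV[R]_k -> R) :
    outer_class U D f g -> outer_class U D f h -> outer_class U D f (g + h).

Lemma smooth_on_outer k (U : set 'rV[R]_k) (D : (R -> R) -> Prop) (A : set R)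
    (f : 'rV[R]_k -> R) (h : R -> R) : open U ->
  (forall h, D h -> exists2 h', D h' & forall t, A t -> is_derive t 1 h (h' t)) ->
  (forall x, U x -> A (f x)) -> smooth_on U f -> D h -> smooth_on U (h \o f).
Proof.
move=> oU dD UA sf Dh.
apply: (@smooth_on_class _ _ _ _ (outer_class U D f) oU).
- move=> g Cg x Ux; elim: Cg => [p h1 sp Dh1|g1 g2 _ c1 _ c2].
    apply: continuousM; first exact: (smooth_on_continuous sp Ux).
    apply: continuous_comp; first exact: (smooth_on_continuous sf Ux).
    have [h' _ /(_ _ (UA _ Ux)) [dh _]] := dD _ Dh1.
    by apply: differentiable_continuous; exact/derivable1_diffP.
  exact: continuousD c1 c2.
- move=> g Cg v; elim: Cg => [p h1 sp Dh1|f1 g1 _ [f1' Cf1 df1] _ [g1' Cg1 dg1]].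
    have [h' Dh' dh'] := dD _ Dh1.
    exists ('D_v p * (h1 \o f) + (p * 'D_v f) * (h' \o f)).
      apply: outer_add; apply: outer_base; [exact: smooth_on_derive|exact: Dh1| |exact: Dh'].
      by apply: smooth_onM; [exact: oU|exact: sp|exact: smooth_on_derive].
    move=> x Ux.
    have d1 : is_derive x v (h1 \o f) (h' (f x) * 'D_v f x).
      rewrite -[x]addr0 -[X in x + X](scale0r v); apply/is_derive_line.
      have -> : (fun s : R => (h1 \o f) (x + s *: v)) =
          h1 \o (fun s : R => f (x + s *: v)) by [].
      apply: is_derive1_comp; first by apply: dh'; rewrite scale0r addr0; exact: UA.
      apply/is_derive_line; rewrite scale0r addr0.
      exact: (smooth_on_is_derive v sf Ux).
    have d2 := is_deriveM (smooth_on_is_derive v sp Ux) d1; apply: (is_derive_eq d2).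
    by rewrite !fctE /GRing.scale /=; ring.
  exists (f1' + g1'); first exact: outer_add.
  by move=> x Ux; exact: (is_deriveD (df1 x Ux) (dg1 x Ux)).
have -> : h \o f = (fun=> 1) * (h \o f) by apply/funext => x; rewrite /= mul1r.
by apply: outer_base; [exact: smooth_on_cst|exact: Dh].
Qed.

Lemma smooth_onV k (U : set 'rV[R]_k) (f : 'rV[R]_k -> R) : open U ->
  (forall x, U x -> f x != 0) -> smooth_on U f ->
  smooth_on U (fun x => (f x)^-1).
Proof.
move=> oU f0 sf.
(* Polynomials in 1/t form a family closed under differentiation: p(1/t) has derivative (- p'
   X^2)(1/t). *)
apply: (@smooth_on_outer _ _
   (fun h => exists p : {poly R}, h = (fun t : R => p.[t^-1]))
   [set t | t != 0] f (fun t => t^-1) oU _ f0 sf).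
  move=> _ [p ->]; exists (fun t => (- p^`() * 'X^2).[t^-1]).
    by exists (- p^`() * 'X^2).
  move=> t /= t0.
  have d := is_derive1_comp (is_derive_poly p t^-1) (is_deriveV t0 (is_derive_id t 1)).
  apply: (is_derive_eq d).
  by rewrite !hornerE /GRing.scale /= -exprVn; ring.
by exists 'X; apply/funext => t; rewrite hornerX.
Qed.

(** The functions p(1/t) exp(-1/t), flat at 0, form a family closed under differentiation that
    contains [ell] as [ellp 1]. *)
Definition ellp (p : {poly R}) (t : R) : R :=
  if t <= 0 then 0 else p.[t^-1] * expR (- t^-1).

(** With s = 1/t, the inequality s^(i+1) / (i+1)! <= exp(s) gives s^i exp(-s) <= (i+1)! t for t >
    0. *)
Lemma ellp_bound p : exists2 C, 0 <= C & forall t, `|ellp p t| <= C * `|t|.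
Proof.
exists (\sum_(i < size p) `|p`_i| * (i.+1)`!%:R).
  by apply: sumr_ge0 => i _; rewrite mulr_ge0.
move=> t; rewrite /ellp; have [t0|t0] := leP t 0.
  by rewrite normr0 mulr_ge0// sumr_ge0// => i _; rewrite mulr_ge0.
rewrite (gtr0_norm t0) normrM (ger0_norm (expR_ge0 _)) horner_coef.
have i0 : 0 < t^-1 by rewrite invr_gt0.
rewrite (@le_trans _ _ ((\sum_(i < size p) `|p`_i| * t^-1 ^+ i) * expR (- t^-1)))//.
  rewrite ler_wpM2r ?expR_ge0// (le_trans (ler_norm_sum _ _ _))//.
  by apply: ler_sum => i _; rewrite normrM normrX (gtr0_norm i0).
rewrite !mulr_suml; apply: ler_sum => i _; rewrite -!mulrA ler_wpM2l//.
have := @expR_ge1Dxn R t^-1 i (ltW i0).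
rewrite expRN => H.
rewrite ler_pdivrMr ?expR_gt0//.
have {}H : t^-1 ^+ i.+1 / (i.+1)`!%:R <= expR t^-1.
  by apply: le_trans H; rewrite lerDr.
have {H} := ler_wpM2l (mulr_ge0 (ler0n R (i.+1)`!) (ltW t0)) H.
apply: le_trans; rewrite [leRHS](_ : _ = t^-1 ^+ i)//.
have F0 : (i.+1)`!%:R != 0 :> R by rewrite pnatr_eq0 -lt0n fact_gt0.
have t1 : t != 0 by rewrite gt_eqF.
by rewrite exprS; move: (t^-1 ^+ i) => a; field; rewrite F0 t1.
Qed.

Lemma is_derive_ellp (p : {poly R}) (t : R) :
  is_derive t 1 (ellp p) (ellp ('X^2 * (p - p^`())) t).
Proof.
have [t0|t0|->] := ltgtP t 0.
- rewrite {2}/ellp (ltW t0).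
  apply: (near_eq_is_derive _ (is_derive_cst 0 t 1)).
  by near=> s; rewrite /ellp ifT//; apply/ltW; near: s; exact: lt_nbhsl.
- rewrite {2}/ellp leNgt t0 /=.
  have n0 : t != 0 by rewrite gt_eqF.
  have dV := is_deriveV n0 (is_derive_id t 1).
  have d1 := is_derive1_comp (is_derive_poly p t^-1) dV.
  have d2 := @is_derive1_comp R expR (- (@GRing.inv R)) t _ _ (is_derive_expR _) (is_deriveN dV).
  have d3 := is_deriveM d1 d2.
  apply: near_eq_is_derive (is_derive_eq d3 _).
    near=> s; rewrite /ellp ifF//; apply/negbTE; rewrite -ltNge.
    by near: s; exact: lt_nbhsr.
  rewrite /= !hornerE /GRing.scale /= -exprVn; ring.
- rewrite {2}/ellp lexx; apply/is_derive1_caratheodory.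
  (* The difference quotient of [ellp p] at 0 is again in the family, and it tends to 0 by the
     linear bound. *)
  exists (ellp ('X * p)); split.
  + move=> z; rewrite /ellp lexx !subr0; have [z0|z0] := leP z 0; first by rewrite mul0r.
    by rewrite hornerM hornerX mulrAC [_ * z]mulrAC mulVf ?mul1r// gt_eqF.
  + have [C C0 HC] := ellp_bound ('X * p).
    rewrite /prop_for /continuous_at {2}/ellp lexx.
    apply/cvgr0Pnorm_le => e e0.
    have e1 : 0 < e / (C + 1) by rewrite divr_gt0// ltr_wpDl.
    have := @nbhs0_lt _ R^o _ e1; apply: filterS => z ze.
    rewrite (le_trans (HC _))//.
    move: ze => /ltW; rewrite ler_pdivlMr ?ltr_wpDl// => ze.
    by rewrite mulrC (le_trans _ ze)// ler_wpM2l// lerDl.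
  + by rewrite /ellp lexx.
Unshelve. all: by end_near. Qed.

Lemma smooth_on_ell k (U : set 'rV[R]_k) (f : 'rV[R]_k -> R) : open U ->
  smooth_on U f -> smooth_on U (fun x => ell (f x)).
Proof.
move=> oU sf; have -> : (fun x => ell (f x)) = ellp 1 \o f.
  by apply/funext => x; rewrite /ellp /ell /= hornerE mul1r.
apply: (@smooth_on_outer _ _ (fun h => exists p, h = ellp p) setT f _ oU _ _ sf).
- move=> _ [p ->]; exists (ellp ('X^2 * (p - p^`()))); first by eexists.
  by move=> t _; exact: is_derive_ellp.
- by [].
- by exists 1.
Qed.

Lemma ell_gt0 (t : R) : 0 < t -> 0 < ell t.
Proof. by move=> t0; rewrite /ell leNgt t0 /= expR_gt0. Qed.

Lemma ell_le0 (t : R) : t <= 0 -> ell t = 0.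
Proof. by rewrite /ell => ->. Qed.

Lemma ell_ge0 (t : R) : 0 <= ell t.
Proof. by have [/ell_le0 ->|/ell_gt0 /ltW] := leP t 0. Qed.

(** The denominator never vanishes, as t > 0 or 1 - t > 0. Unlike [lam], this step is seen to be
    smooth without the fundamental theorem of calculus. *)
Definition smoothstep (t : R) : R := ell t / (ell t + ell (1 - t)).

Lemma smoothstep_le0 t : t <= 0 -> smoothstep t = 0.
Proof. by move=> t0; rewrite /smoothstep ell_le0// mul0r. Qed.

Lemma smoothstep_ge1 t : 1 <= t -> smoothstep t = 1.
Proof.
move=> t1; rewrite /smoothstep (@ell_le0 (1 - t)) ?subr_le0// addr0 divff//.
by rewrite gt_eqF// ell_gt0// (lt_le_trans _ t1).
Qed.

Lemma smooth_on_smoothstep k (U : set 'rV[R]_k) (f : 'rV[R]_k -> R) : open U ->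
  smooth_on U f -> smooth_on U (fun x => smoothstep (f x)).
Proof.
move=> oU sf.
have s1 := smooth_on_ell oU sf.
have s2 : smooth_on U (fun x => ell (1 - f x)).
  apply: (smooth_on_ell oU); apply: smooth_onB; [exact: oU| |exact: sf].
  exact: smooth_on_cst.
apply: smooth_onM; [exact: oU|exact: s1|].
apply: smooth_onV; [exact: oU| |by apply: smooth_onD; [exact: oU|exact: s1|exact: s2]].
move=> x _; have [t0|t0] := leP (f x) 0.
  by rewrite gt_eqF// ltr_wpDl ?ell_ge0// ell_gt0// subr_gt0 (le_lt_trans t0).
by rewrite gt_eqF// ltr_wpDr ?ell_ge0// ell_gt0.
Qed.

End Outer.

(** * Seeley's extension of functions smooth on a half space *)

Section SeeleyCoefficients.
Variable R : realType.

(* Taylor coefficients of prod_(j >= 1) (1 - 8^(-j) z), which vanishes at z = 8^i,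
   so that sum_k c_k 8^(k i) = 0 for all i >= 1; dividing by 8^k + 1 turns this into
   moments of alternating sign. *)
Fixpoint seeley_c (k : nat) : R :=
  if k is k'.+1 then - seeley_c k' / (8 ^+ k - 1) else 1.

Lemma seeley_den k : 7 <= 8 ^+ k.+1 - 1 :> R.
Proof.
rewrite exprS; have : 1 <= 8 ^+ k :> R by rewrite exprn_ege1// ler1n.
by lra.
Qed.

(** Induction on [i]: the extra factor [8 ^+ k.+1] of the next moment is absorbed, up to a factor 2,
    by the denominator [8 ^+ k.+1 - 1] of the recurrence. *)
Lemma seeley_c_bound i : exists C, forall k,
  `|seeley_c k| * (8 ^+ k) ^+ i <= C / 2 ^+ k.
Proof.
elim: i => [|i [C HC]].
  exists 1; elim=> [|k IH]; first by rewrite /= normr1 expr0 mulr1 divr1.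
  rewrite expr0 mulr1 /= normrM normrN normfV.
  have d7 := seeley_den k; have d0 : 0 < 8 ^+ k.+1 - 1 :> R by lra.
  rewrite (gtr0_norm d0) ler_pdivrMr//; move: IH; rewrite expr0 mulr1.
  move=> /le_trans; apply; rewrite exprS invfM.
  have : 0 < 2 ^- k :> R by rewrite invr_gt0 exprn_gt0.
  by nra.
have C0 : 0 <= C.
  by have := HC 0%N; rewrite /= normr1 expr0 expr1n mulr1 divr1; lra.
exists (4 * 8 ^+ i * C + 1); case=> [|k].
  rewrite /= normr1 expr0 expr1n mulr1 divr1 lerDr.
  by rewrite !mulr_ge0// exprn_ge0.
rewrite /= normrM normrN normfV (exprSr (8 ^+ k.+1) i).
have d7 := seeley_den k; have d0 : 0 < 8 ^+ k.+1 - 1 :> R by lra.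
rewrite (gtr0_norm d0).
have -> : `|seeley_c k| / (8 ^+ k.+1 - 1) * ((8 ^+ k.+1) ^+ i * 8 ^+ k.+1) =
  (`|seeley_c k| * (8 ^+ k) ^+ i) * 8 ^+ i * (8 ^+ k.+1 / (8 ^+ k.+1 - 1)).
  have -> : (8 ^+ k.+1) ^+ i = (8 ^+ k) ^+ i * 8 ^+ i :> R.
    by rewrite -exprMn -exprSr.
  by ring.
have q2 : 8 ^+ k.+1 / (8 ^+ k.+1 - 1) <= 2 :> R.
  by rewrite ler_pdivrMr//; lra.
have q0 : 0 <= 8 ^+ k.+1 / (8 ^+ k.+1 - 1) :> R.
  by rewrite divr_ge0 ?exprn_ge0// ltW.
apply: (@le_trans _ _ ((C / 2 ^+ k) * 8 ^+ i * 2)).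
  apply: ler_pM => //.
  by rewrite ler_wpM2r// exprn_ge0.
rewrite exprS invfM.
have h0 : 0 < 2 ^- k :> R by rewrite invr_gt0 exprn_gt0.
have b0 : 0 <= 8 ^+ i :> R by rewrite exprn_ge0.
by nra.
Qed.

Lemma cvg_series_bound (u : R^nat) C : (forall k, `|u k| <= C / 2 ^+ k) ->
  cvgn (series u).
Proof.
move=> uC; apply: normed_cvg; apply: (series_le_cvg (v_ := geometric C 2^-1)).
- by move=> n; exact: normr_ge0.
- move=> n; rewrite /geometric /= mulr_ge0 ?exprn_ge0//.
  by have := le_trans (normr_ge0 _) (uC 0%N); rewrite expr0 divr1.
- by move=> n; rewrite /geometric /= exprVn.
- by apply: is_cvg_geometric_series; rewrite ger0_norm// invf_lt1// ltr1n.
Qed.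


Let S i := limn (series (fun k => seeley_c k * (8 ^+ k) ^+ i)).

Lemma is_cvg_seeley_c i : cvgn (series (fun k => seeley_c k * (8 ^+ k) ^+ i)).
Proof.
have [C HC] := seeley_c_bound i; apply: (@cvg_series_bound _ C) => k.
by rewrite normrM (@ger0_norm _ ((8 ^+ k) ^+ i)) ?exprn_ge0.
Qed.

(** The recurrence reads c_k 8^k = c_k - c_(k-1); multiply by 8^(k i) and sum over k. *)
Lemma seeley_S i : S i.+1 = (1 - 8 ^+ i) * S i.
Proof.
suff H : series (fun k => seeley_c k * (8 ^+ k) ^+ i.+1) @ \oo --> (1 - 8 ^+ i) * S i.
  exact/cvg_lim.
rewrite -cvg_shiftS /=.
have -> : (fun n => series (fun k => seeley_c k * (8 ^+ k) ^+ i.+1) n.+1) =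
  (fun n => series (fun k => seeley_c k * (8 ^+ k) ^+ i) n.+1
      - 8 ^+ i * series (fun k => seeley_c k * (8 ^+ k) ^+ i) n).
  apply/funext => n; rewrite /series /=.
  elim: n => [|n IH].
    by rewrite !big_nat1 big_geq// mulr0 subr0 expr0 !expr1n.
  rewrite [LHS]big_nat_recr//= IH [in RHS]big_nat_recr//=.
  rewrite [X in _ = _ - _ * X]big_nat_recr//=.
  have d7 := seeley_den n.
  have d0 : 8 ^+ n.+1 - 1 != 0 :> R by rewrite gt_eqF//; lra.
  rewrite (exprSr (8 ^+ n.+1) i).
  have -> : (8 ^+ n.+1) ^+ i = (8 ^+ n) ^+ i * 8 ^+ i :> R by rewrite -exprMn -exprSr.
  by move: (8 ^+ n.+1) d0 => b d0; field.
rewrite mulrBl mul1r; apply: cvgB; first by rewrite (cvg_shiftS (series _)); exact: is_cvg_seeley_c.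
by apply: cvgMl_tmp; exact: is_cvg_seeley_c.
Qed.

Lemma seeley_S0 i : S i.+1 = 0.
Proof.
elim: i => [|i IH]; rewrite seeley_S; first by rewrite expr0 subrr mul0r.
by rewrite IH mulr0.
Qed.

(** The moments of [seeley_c] vanish only from the first on. The numerator [8 ^+ k] shifts them by
    one, so that consecutive moments of [seeley_t] cancel already from [i = 0]. *)
Definition seeley_t k : R := seeley_c k * 8 ^+ k / (8 ^+ k + 1).

Lemma seeley_t_le k : `|seeley_t k| <= `|seeley_c k|.
Proof.
have b0 : 0 < 8 ^+ k :> R by rewrite exprn_gt0.
have b1 : 0 < 8 ^+ k + 1 :> R by lra.
rewrite /seeley_t -mulrA normrM ler_piMr// ger0_norm; last by rewrite divr_ge0// ltW.
by rewrite ler_pdivrMr// mul1r lerDl.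
Qed.

Lemma seeley_t_bound i : exists C, forall k,
  `|seeley_t k * (8 ^+ k) ^+ i| <= C / 2 ^+ k.
Proof.
have [C HC] := seeley_c_bound i; exists C => k; apply: le_trans (HC k).
rewrite normrM (@ger0_norm _ ((8 ^+ k) ^+ i)) ?exprn_ge0// ler_wpM2r ?exprn_ge0//.
exact: seeley_t_le.
Qed.

Let T i := limn (series (fun k => seeley_t k * (8 ^+ k) ^+ i)).

Lemma is_cvg_seeley_t i : cvgn (series (fun k => seeley_t k * (8 ^+ k) ^+ i)).
Proof. by have [C HC] := seeley_t_bound i; exact: cvg_series_bound HC. Qed.

Lemma seeley_T i : T i.+1 = - T i.
Proof.
apply/eqP; rewrite -addr_eq0; apply/eqP; rewrite -(seeley_S0 i) /T.
rewrite -lim_seriesD; [|exact: is_cvg_seeley_t|exact: is_cvg_seeley_t].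
congr (limn (series _)); apply/funext => k; rewrite !fctE /= /seeley_t.
have b0 : 0 < 8 ^+ k :> R by rewrite exprn_gt0.
have b1 : 8 ^+ k + 1 != 0 :> R by rewrite gt_eqF//; lra.
by rewrite exprSr; move: (8 ^+ k) b1 => b b1; field.
Qed.

(** The term k = 0 is 1/2 and the others are bounded by 7^(-k), whose sum is 1/6. Dividing by this
    moment is what normalizes the coefficients. *)
Lemma seeley_T0 : 0 < T 0.
Proof.
have H n : 1 / 2 - (1 - 7 ^- n) / 6 <=
    series (fun k => seeley_t k * (8 ^+ k) ^+ 0) n.+1.
  elim: n => [|n IH].
    by rewrite /series /= big_nat1 /seeley_t /= !expr0 invr1 subrr mul0r !mulr1 subr0.
  move: IH; rewrite /series /= => IH; rewrite big_nat_recr//=.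
  have c7 k : `|seeley_c k| <= 7 ^- k.
    elim: k => [|k IHk]; first by rewrite /= normr1 expr0 invr1.
    rewrite /= normrM normrN normfV.
    have d7 := seeley_den k; have d0 : 0 < 8 ^+ k.+1 - 1 :> R by lra.
    rewrite (gtr0_norm d0) ler_pdivrMr// (le_trans IHk)// exprS invfM.
    have : 0 < 7 ^- k :> R by rewrite invr_gt0 exprn_gt0.
    by nra.
  have := le_trans (seeley_t_le n.+1) (c7 n.+1); rewrite ler_norml => /andP[t1 _].
  rewrite [_ ^+ 0]expr0 mulr1.
  have E : 7 ^- n = 7 * 7 ^- n.+1 :> R by rewrite exprS invfM mulrA divff ?mul1r.
  by move: IH; rewrite E; lra.
apply: (@lt_le_trans _ _ (1 / 3)); first by rewrite divr_gt0.
apply: limr_ge; first exact: is_cvg_seeley_t.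
near=> n; have n0 : (0 < n)%N by near: n; exact: nbhs_infty_gt.
rewrite -(prednK n0) (le_trans _ (H _))//.
have : 0 < 7 ^- n.-1 :> R by rewrite invr_gt0 exprn_gt0.
by lra.
Unshelve. all: by end_near. Qed.

Lemma seeley_coefficients : exists a : R^nat,
  (forall i, exists C, forall k, `|a k * (8 ^+ k) ^+ i| <= C / 2 ^+ k) /\
  (forall i, series (fun k => a k * (- (8 ^+ k)) ^+ i) @ \oo --> (1 : R)).
Proof.
exists (fun k => (T 0)^-1 * seeley_t k); split => i.
  have [C HC] := seeley_t_bound i; exists ((T 0)^-1 * C) => k.
  have p : 0 < (T 0)^-1 by rewrite invr_gt0 seeley_T0.
  by rewrite -mulrA normrM (gtr0_norm p) -[leRHS]mulrA ler_pM2l.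
have TE : T i = (-1) ^+ i * T 0.
  elim: i => [|i IH]; first by rewrite expr0 mul1r.
  by rewrite seeley_T IH exprS mulN1r mulNr.
have E : ((T 0)^-1 * (-1) ^+ i) * T i = 1.
  have T0 : T 0 != 0 by rewrite gt_eqF// seeley_T0.
  by rewrite TE mulrA -[_ * _ * (-1) ^+ i]mulrA -expr2 sqrr_sign mulr1 mulVf.
rewrite -[X in _ --> X]E [X in series X](_ : _ =
  ((T 0)^-1 * (-1) ^+ i) *: (fun k => seeley_t k * (8 ^+ k) ^+ i)); last first.
  apply/funext => k; rewrite /= exprNn !fctE /GRing.scale /=.
  by ring.
have := is_cvg_seriesZ (k := (T 0)^-1 * (-1) ^+ i) (@is_cvg_seeley_t i).
by rewrite /T lim_seriesZ//; exact: is_cvg_seeley_t.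
Qed.

End SeeleyCoefficients.

(** * Derivatives across a hyperplane *)

Section Gluing.
Variable R : realType.

(* The segment from x to x + h v is first pushed off the hyperplane by a small
   multiple of the normal vector, where the mean value theorem applies. *)
Lemma is_derive_across_hyperplane k (i0 : 'I_k) (f df : 'rV[R]_k -> R) (v : 'rV[R]_k) :
  continuous f -> continuous df ->
  (forall x : 'rV[R]_k, x ord0 i0 != 0 -> is_derive x v f (df x)) ->
  forall x, is_derive x v f (df x).
Proof.
move=> cf cdf D x; have [x0|] := eqVneq (x ord0 i0) 0; last exact: D.
pose e : 'rV[R]_k := delta_mx ord0 i0.
suff H : h^-1 *: (f (h *: v + x) - f x) @[h --> (0 : R)^'] --> df x.
  by split; [apply/cvg_ex; exists (df x); exact: H|exact/cvg_lim].
apply/cvgrPdist_le => /= eps e0.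
have /nbhs_ballP [r /= r0 rP] : \forall y \near x, `|df y - df x| <= eps.
  by have /cvgr_distC_le := cdf x; exact.
have v0 : 0 < `|v| + 1 by rewrite ltr_wpDl.
have r1 : 0 < r / 2 / (`|v| + 1) by rewrite !divr_gt0.
near=> h.
have h0 : h != 0 by near: h; exact: nbhs_dnbhs_neq.
have hr : `|h| < r / 2 / (`|v| + 1) by near: h; exact: dnbhs0_lt.
have hv : `|h *: v| < r / 2.
  rewrite normrZ; move: hr; rewrite ltr_pdivlMr//; apply: le_lt_trans.
  by rewrite ler_wpM2l// lerDl.
(* The push goes to the side towards which [h *: v] moves, so the pushed segment never meets the
   hyperplane. *)
pose sg : R := if 0 <= h * v ord0 i0 then 1 else -1.
have step (t : R) : 0 < t -> t < r / 2 ->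
    `|f (x + (t * sg) *: e + h *: v) - f (x + (t * sg) *: e) - h * df x| <= eps * `|h|.
  move=> t0 tr.
  have inball s : 0 <= s <= 1 -> ball x r (x + (t * sg) *: e + s *: (h *: v)).
    move=> /andP[s0 s1]; rewrite -ball_normE /ball_ /=.
    rewrite -addrA opprD addrA subrr sub0r normrN.
    rewrite (le_lt_trans (ler_normD _ _))// [r in X in _ < X]splitr ltr_leD//.
      rewrite normrZ (le_lt_trans _ tr)// -[leRHS]mulr1 ler_pM//; last exact: norm_delta_mx.
      by rewrite normrM gtr0_norm// /sg; case: ifP => _; rewrite ?normrN normr1 mulr1.
    rewrite normrZ ger0_norm// (le_trans _ (ltW hv))//.
    by rewrite -[leRHS]mul1r ler_wpM2r.
  have [s s01 E] : exists2 s : R, 0 <= s <= 1 &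
      f (x + (t * sg) *: e + h *: v) - f (x + (t * sg) *: e) =
      h * df (x + (t * sg) *: e + s *: (h *: v)).
    apply: (@line_MVT R k f (fun y => h * df y)) => s /andP[s0 s1].
    apply: is_derive_scale; apply: D.
    rewrite !mxE !eqxx mulr1 x0 add0r /sg; case: ifPn => [hv0|].
      by rewrite mulr1 gt_eqF// ltr_pwDl// mulr_ge0.
    rewrite -ltNge => /ltW hv0; rewrite mulrN1 lt_eqF//.
    by have := mulr_ge0_le0 s0 hv0; lra.
  rewrite E -mulrBr normrM mulrC ler_wpM2r//.
  exact: (rP _ (inball s s01)).
have H : `|f (h *: v + x) - f x - h * df x| <= eps * `|h|.
  have cl (w : 'rV[R]_k) : f (w + (t * sg) *: e) @[t --> (0 : R)^'+] --> f w.
    have c : w + (t * sg) *: e @[t --> (0 : R)] --> w + (0 * sg) *: e.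
      apply: cvgD; first exact: cvg_cst.
      by apply: cvgZr_tmp; apply: cvgMr_tmp; exact: cvg_id.
    have := cvg_comp _ _ c (cf _).
    rewrite mul0r scale0r addr0; exact: cvg_at_right_filter.
  have c1 : `|f (h *: v + x + (t * sg) *: e) - f (x + (t * sg) *: e) - h * df x|
      @[t --> (0 : R)^'+] --> `|f (h *: v + x) - f x - h * df x|.
    by apply: cvg_norm; apply: cvgB; [apply: cvgB; exact: cl|exact: cvg_cst].
  rewrite -(cvg_lim _ c1)//; apply: limr_le; first by apply/cvg_ex; eexists; exact: c1.
  near=> t; rewrite [h *: v + x]addrC [x + h *: v + _]addrAC; apply: step.
    by near: t; exact: nbhs_right_gt.
  by near: t; apply: nbhs_right_lt; rewrite divr_gt0.
rewrite distrC -[X in `|_ - X|]scale1r -(mulVf h0) -scalerA -scalerBr normrZ normfV.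
by rewrite ler_pdivrMl ?normr_gt0// mulrC.
Unshelve. all: by end_near. Qed.

End Gluing.

(** * Derivatives in an auxiliary variable *)

Section ParametricDerivative.
Variable R : realType.

Lemma derive1_slice k (V : normedModType R) (f : 'rV[R]_(k + 1) -> V)
    (x : 'rV[R]_k) (z : R) :
  derive1 (fun z : R => f (row_mx x z%:M)) z =
  'D_(row_mx 0 1%:M) f (row_mx x z%:M).
Proof.
have E : (fun h : R => h^-1 *: (f (row_mx x (h + z)%:M) - f (row_mx x z%:M))) =
   (fun h : R => h^-1 *: ((f \o shift (row_mx x z%:M)) (h *: row_mx 0 1%:M)
       - f (row_mx x z%:M))).
  apply/funext => h /=; congr (_ *: (f _ - _)).
  by rewrite scale_row_mx scaler0 add_row_mx add0r scale_scalar_mx mulr1 raddfD.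
by rewrite /derive1 /derive E.
Qed.

Lemma derive1n_slice k (V : normedModType R) (f : 'rV[R]_(k + 1) -> V)
    (x : 'rV[R]_k) n (z : R) :
  derive1n n (fun z : R => f (row_mx x z%:M)) z =
  iter n (fun g => 'D_(row_mx 0 1%:M) g) f (row_mx x z%:M).
Proof.
elim: n z => [//|n IH] z; rewrite derive1nS iterS -derive1_slice.
by congr (derive1 _ z); apply/funext => y; exact: IH.
Qed.

Lemma smooth_on_iter_derive k (V : normedModType R) (U : set 'rV[R]_k)
    (f : 'rV[R]_k -> V) v n :
  smooth_on U f -> smooth_on U (iter n (fun g => 'D_v g) f).
Proof. by move=> sf; elim: n => [//|n IH]; rewrite iterS; exact: smooth_on_derive. Qed.

Lemma smooth_on_lsubmx k l (U : set 'rV[R]_(k + l)) : open U ->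
  smooth_on U (fun y : 'rV[R]_(k + l) => lsubmx y).
Proof.
move=> oU; apply: smooth_on_rV => [|i]; first exact: oU.
have -> : (fun y : 'rV[R]_(k + l) => lsubmx y ord0 i) =
    (fun y => y ord0 (lshift l i)) by apply/funext => y; rewrite mxE.
exact: smooth_on_coord.
Qed.

Lemma smooth_on_rsubmx k l (U : set 'rV[R]_(k + l)) : open U ->
  smooth_on U (fun y : 'rV[R]_(k + l) => rsubmx y).
Proof.
move=> oU; apply: smooth_on_rV => [|i]; first exact: oU.
have -> : (fun y : 'rV[R]_(k + l) => rsubmx y ord0 i) =
    (fun y => y ord0 (rshift k i)) by apply/funext => y; rewrite mxE.
exact: smooth_on_coord.
Qed.

Lemma smooth_on_row_mx k' k l (U : set 'rV[R]_k') (F : 'rV[R]_k' -> 'rV[R]_k)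
    (G : 'rV[R]_k' -> 'rV[R]_l) : open U ->
  smooth_on U F -> smooth_on U G -> smooth_on U (fun x => row_mx (F x) (G x)).
Proof.
move=> oU sF sG; apply: smooth_on_rV => [|i]; first exact: oU.
case: (splitP i) => j ij.
  have -> : (fun x => row_mx (F x) (G x) ord0 i) = (fun x => F x ord0 j).
    by apply/funext => x; rewrite (_ : i = lshift l j) ?row_mxEl//; exact/val_inj.
  exact: rV_smooth_on.
have -> : (fun x => row_mx (F x) (G x) ord0 i) = (fun x => G x ord0 j).
  by apply/funext => x; rewrite (_ : i = rshift k j) ?row_mxEr//; exact/val_inj.
exact: rV_smooth_on.
Qed.

Lemma smooth_on_scalar_mx k' (U : set 'rV[R]_k') (f : 'rV[R]_k' -> R) :
  open U -> smooth_on U f -> smooth_on U (fun x => (f x)%:M : 'rV[R]_1).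
Proof.
move=> oU sf; apply: smooth_on_rV => [|i]; first exact: oU.
have -> : (fun x => (f x)%:M ord0 i : R) = f; last exact: sf.
by apply/funext => x; rewrite mxE (ord1 i) eqxx mulr1n.
Qed.

Lemma smooth_on_scale k' k (U : set 'rV[R]_k') (f : 'rV[R]_k' -> R)
    (F : 'rV[R]_k' -> 'rV[R]_k) :
  open U -> smooth_on U f -> smooth_on U F -> smooth_on U (fun x => f x *: F x).
Proof.
move=> oU sf sF; apply: smooth_on_rV => [|i]; first exact: oU.
have -> : (fun x => (f x *: F x) ord0 i) = (fun x => f x * F x ord0 i).
  by apply/funext => x; rewrite mxE.
by apply: smooth_onM; [exact: oU|exact: sf|exact: rV_smooth_on].
Qed.

Lemma smooth_on_id k (U : set 'rV[R]_k) : open U -> smooth_on U id.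
Proof.
by move=> oU; apply: smooth_on_rV => [|i]; [exact: oU|exact: smooth_on_coord].
Qed.

(** The derivative in the auxiliary variable is an iterated directional derivative of [f] on the
    cylinder over [U], restricted to the slice z = 0. *)
Lemma smooth_on_derive1n k (U : set 'rV[R]_k) (f : 'rV[R]_(k + 1) -> R) n :
  open U -> smooth_on [set y | U (lsubmx y)] f ->
  smooth_on U (fun x => derive1n n (fun z : R => f (row_mx x z%:M)) 0).
Proof.
move=> oU sf.
have oW : open [set y : 'rV[R]_(k + 1) | U (lsubmx y)].
  by apply: open_comp oU => y _; exact: continuous_lsubmx.
have -> : (fun x => derive1n n (fun z : R => f (row_mx x z%:M)) 0) =
    iter n (fun g => 'D_(row_mx 0 1%:M) g) f \o (fun x => row_mx x 0%:M).
  by apply/funext => x; exact: derive1n_slice.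
apply: (smooth_on_comp_real oW oU).
- by move=> x Ux /=; rewrite row_mxKl.
- exact: smooth_on_iter_derive.
- by apply: smooth_on_row_mx; [exact: oU|exact: smooth_on_id|exact: smooth_on_cst].
Qed.

End ParametricDerivative.

(** * Derivatives up to the boundary of a half space *)

Section HalfSpace.
Variables (R : realType) (k : nat) (i0 : 'I_k).

(* Smoothness on the half space {0 <= x_i0} in the sense of its subset
   diffeology: only compositions with smooth maps into it are tested. *)
Definition hsmooth (g : 'rV[R]_k -> R) : Prop :=
  forall k' (U : set 'rV[R]_k') (F : 'rV[R]_k' -> 'rV[R]_k), open U ->
    smooth_on U F -> (forall x, U x -> 0 <= F x ord0 i0) -> smooth_on U (g \o F).

Let e : 'rV[R]_k := delta_mx ord0 i0.

Lemma e_i0 : e ord0 i0 = 1. Proof. by rewrite /e mxE !eqxx. Qed.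

(** For [F] into the half space, (x, z) |-> F x + z^m w still has values in it, so [g] composed with
    it is smooth on a cylinder and its z-derivatives at 0 are smooth in x. No derivative of [g] at
    the boundary is presupposed. *)
Lemma hsmooth_derive1n g (w : 'rV[R]_k) n m : hsmooth g ->
  (forall z : R, 0 <= z ^+ m * w ord0 i0) ->
  hsmooth (fun y => derive1n n (fun z : R => g (y + z ^+ m *: w)) 0).
Proof.
move=> hg hw k' U F oU sF F0.
have oW : open [set y : 'rV[R]_(k' + 1) | U (lsubmx y)].
  by apply: open_comp oU => y _; exact: continuous_lsubmx.
pose G (y : 'rV[R]_(k' + 1)) := F (lsubmx y) + (rsubmx y ord0 ord0) ^+ m *: w.
have := @smooth_on_derive1n R k' U (g \o G) n oU.
have -> : (fun x => derive1n n (fun z : R => (g \o G) (row_mx x z%:M)) 0) =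
  (fun y => derive1n n (fun z : R => g (y + z ^+ m *: w)) 0) \o F.
  apply/funext => x /=; congr (derive1n n _ 0); apply/funext => z /=.
  by rewrite /G row_mxKl row_mxKr mxE eqxx mulr1n.
apply; apply: hg; first exact: oW.
- apply: smooth_onD; first exact: oW.
    by apply: (smooth_on_comp oU oW _ sF); [move=> y|exact: (smooth_on_lsubmx oW)].
  apply: smooth_on_scale; [exact: oW| |exact: smooth_on_cst].
  apply: smooth_onX; first exact: oW.
  apply: (@rV_smooth_on _ _ _ _ _ ord0 oW); exact: smooth_on_rsubmx.
- by move=> y Wy; rewrite /G !mxE addr_ge0// F0.
Qed.

(** The exponent 1 and [derive1n 1] make this an instance of [hsmooth_derive1n]; [w] is meant to be
    parallel to the boundary. *)
Definition tangential (w : 'rV[R]_k) (g : 'rV[R]_k -> R) (y : 'rV[R]_k) : R :=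
  derive1n 1 (fun z : R => g (y + z ^+ 1 *: w)) 0.

(* The normal derivative at a boundary point is read off the even curve
   z |-> y + z^2 e, which stays in the half space. *)
Definition normald (g : 'rV[R]_k -> R) (y : 'rV[R]_k) : R :=
  2^-1 * derive1n 2 (fun z : R => g (y + z ^+ 2 *: e)) 0.

Lemma hsmooth_tangential (w : 'rV[R]_k) g : w ord0 i0 = 0 -> hsmooth g -> hsmooth (tangential w g).
Proof. by move=> w0 hg; apply: hsmooth_derive1n hg _ => z; rewrite w0 mulr0. Qed.

Lemma hsmooth_normald g : hsmooth g -> hsmooth (normald g).
Proof.
move=> hg k' U F oU sF F0; apply: smooth_onM; [exact: oU|exact: smooth_on_cst|].
apply: (@hsmooth_derive1n g e 2 2 hg _ _ U F oU sF F0) => z.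
by rewrite e_i0 mulr1 sqr_ge0.
Qed.

Definition halfopen : set 'rV[R]_k := [set y | 0 < y ord0 i0].

Lemma open_halfopen : open halfopen.
Proof. by apply: (open_comp (D := [set t : R | 0 < t])) => [y _|]; [exact: coord_continuous|exact: open_gt]. Qed.

Lemma hsmooth_halfopen g : hsmooth g -> smooth_on halfopen g.
Proof.
move=> hg; apply: (hg _ _ id open_halfopen); first exact: smooth_on_id open_halfopen.
by move=> x /ltW.
Qed.

(** The curve z |-> g (y + z^2 e) has derivative 2 z D_e g (y + z^2 e), whose slope at 0 is 2 D_e g
    (y) by continuity of D_e g; hence the factor 1/2. *)
Lemma normald_halfopen g (y : 'rV[R]_k) : hsmooth g -> halfopen y -> normald g y = 'D_e g y.
Proof.
move=> hg y0; have sg := hsmooth_halfopen hg.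
pose dg (s : R) := 'D_e g (y + s *: e).
have D : \forall s \near (0 : R), is_derive (s : R) 1 (fun s : R => g (y + s *: e)) (dg s).
  near=> s; apply/is_derive_line; apply: (smooth_on_is_derive _ sg).
  rewrite /halfopen /= !mxE !eqxx mulr1.
  have : - y ord0 i0 < s by near: s; apply: lt_nbhsr; rewrite oppr_lt0.
  by lra.
have D2 : \forall z \near (0 : R),
    derive1 (fun z : R => g (y + z ^+ 2 *: e)) z = 2 * z * dg (z ^+ 2).
  have c2 : z ^+ 2 @[z --> (0 : R)] --> (0 : R).
    by have := @exprn_continuous R 2 0; rewrite /continuous_at expr0n.
  have D' : \forall z \near (0 : R),
      is_derive (z ^+ 2 : R) 1 (fun s : R => g (y + s *: e)) (dg (z ^+ 2)) := c2 _ D.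
  apply: filterS D' => z Dz.
  have dz := is_deriveX 2 (is_derive_id z (1 : R)).
  have dz' : is_derive z 1 (fun z : R => z ^+ 2) (2 * z).
    have -> : (fun z : R => z ^+ 2) = (id : R -> R) ^+ 2 by [].
    by apply: (is_derive_eq dz); rewrite /= expr1 [_ *: 1]mulr1.
  have d := @is_derive1_comp R (fun s : R => g (y + s *: e)) (fun z => z ^+ 2) z _ _ Dz dz'.
  by rewrite derive1E (@derive_val _ _ _ _ _ _ _ d) mulrC.
rewrite /normald derive1nS derive1n1 derive1E (near_eq_derive _ D2).
have d : is_derive (0 : R) 1 (fun z : R => 2 * z * dg (z ^+ 2)) (2 * dg 0).
  apply/is_derive1_caratheodory; exists (fun z => 2 * dg (z ^+ 2)); split.
  - by move=> z; rewrite mulr0 mul0r !subr0 mulrAC.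
  - rewrite /prop_for /continuous_at expr0n /=; apply: cvgMl_tmp.
    have cdg : dg s @[s --> (0 : R)] --> dg 0.
      have c : y + s *: e @[s --> (0 : R)] --> y + 0 *: e.
        by apply: cvgD; [exact: cvg_cst|apply: cvgZr_tmp; exact: cvg_id].
      have cD : {for y + (0 : R) *: e, continuous ('D_e g)}.
        rewrite scale0r addr0.
        exact: (smooth_on_continuous (smooth_on_derive e sg) y0).
      exact: (cvg_comp _ _ c cD).
    have c2 : z ^+ 2 @[z --> (0 : R)] --> (0 : R).
      by have := @exprn_continuous R 2 0; rewrite /continuous_at expr0n.
    exact: (cvg_comp _ _ c2 cdg).
  - by rewrite expr0n.
by rewrite (@derive_val _ _ _ _ _ _ _ d) mulrA mulVf// mul1r /dg scale0r addr0.
Unshelve. all: by end_near. Qed.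

Lemma tangentialE (w : 'rV[R]_k) g y : tangential w g y = 'D_w g y.
Proof.
have E : (fun h : R => h^-1 *: (g (y + (h + 0) ^+ 1 *: w) - g (y + 0 ^+ 1 *: w))) =
    (fun h : R => h^-1 *: ((g \o shift y) (h *: w) - g y)).
  by apply/funext => h /=; rewrite addr0 !expr1 scale0r addr0 [y + _]addrC.
by rewrite /tangential derive1n1 /derive1 /derive E.
Qed.

(** Splitting [v] into a part parallel to the boundary and a normal part expresses the derivative by
    functions that are again [hsmooth], boundary included. *)
Lemma is_derive_halfopen g (y v : 'rV[R]_k) : hsmooth g -> halfopen y ->
  is_derive y v g
    (tangential (v - v ord0 i0 *: e) g y + v ord0 i0 * normald g y).
Proof.
move=> hg y0; have sg := hsmooth_halfopen hg.
apply: (is_derive_eq (smooth_on_is_derive v sg y0)).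
have [dg _] := smooth_on_differentiable open_halfopen sg y0.
rewrite tangentialE (normald_halfopen hg y0) !deriveE//.
by rewrite -[_ * _]/(_ *: _) -linearZ -linearD subrK.
Qed.

End HalfSpace.

(** * The Seeley series and its derivatives *)

Section SeeleyExtension.
Variables (R : realType) (k : nat) (i0 : 'I_k) (a : R^nat).
Implicit Types (x y v w : 'rV[R]_k) (g : 'rV[R]_k -> R).
Hypothesis a_bound : forall i, exists C, forall j, `|a j * (8 ^+ j) ^+ i| <= C / 2 ^+ j.
Hypothesis a_moment : forall i, series (fun j => a j * (- (8 ^+ j)) ^+ i) @ \oo --> (1 : R).

Let e : 'rV[R]_k := delta_mx ord0 i0.

(** Reflection in the boundary followed by dilation by 8^j in the normal direction; the other
    coordinates are kept. *)
Let dilate (j : nat) (x : 'rV[R]_k) : 'rV[R]_k := x - ((1 + 8 ^+ j) * x ord0 i0) *: e.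

Let dilate_i0 j x : dilate j x ord0 i0 = - (8 ^+ j * x ord0 i0).
Proof. by rewrite /dilate !mxE !eqxx mulr1; ring. Qed.

Let dilateD j (x v : 'rV[R]_k) (h : R) : dilate j (h *: v + x) = h *: dilate j v + dilate j x.
Proof.
by apply/rowP => i; rewrite /dilate !mxE; ring.
Qed.

Let proj (x : 'rV[R]_k) : 'rV[R]_k := x - x ord0 i0 *: e.

Let proj_i0 x : proj x ord0 i0 = 0.
Proof. by rewrite /proj !mxE !eqxx mulr1 subrr. Qed.

Let proj_dilate j x : proj (dilate j x) = proj x.
Proof. by rewrite /proj dilate_i0 /dilate; apply/rowP => i; rewrite !mxE; ring. Qed.

Let norm_proj x : `|proj x| <= 2 * `|x|.
Proof.
rewrite /proj (le_trans (ler_normB _ _))// mulr_natl mulr2n lerD// normrZ.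
by rewrite -[leRHS]mulr1 ler_pM// ?norm_coord// norm_delta_mx.
Qed.

(** The retraction to the half space that replaces a negative normal coordinate by 0, since
    [Num.sqrt] vanishes on negative numbers. The square of a root matches the factorization in
    [hsmooth_continuous]. *)
Definition sqclamp (x : 'rV[R]_k) : 'rV[R]_k :=
  x + (Num.sqrt (x ord0 i0) ^+ 2 - x ord0 i0) *: e.

Lemma sqclamp_ge0 x : 0 <= x ord0 i0 -> sqclamp x = x.
Proof. by move=> x0; rewrite /sqclamp sqr_sqrtr// subrr scale0r addr0. Qed.

Lemma sqclamp_le0 x : x ord0 i0 <= 0 -> sqclamp x = proj x.
Proof.
move=> x0; rewrite /sqclamp ler0_sqrtr// expr0n /= sub0r scaleNr.
by [].
Qed.

Lemma sqclampE x : sqclamp x = if 0 <= x ord0 i0 then x else proj x.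
Proof.
case: ifPn => [/sqclamp_ge0//|]; rewrite -ltNge => /ltW; exact: sqclamp_le0.
Qed.

(* Composing with squaring in the normal direction gives a smooth function,
   from which g is recovered by taking a square root. *)
Lemma hsmooth_continuous g : hsmooth i0 g -> continuous (g \o sqclamp).
Proof.
move=> hg x.
pose S (y : 'rV[R]_k) := y + (y ord0 i0 ^+ 2 - y ord0 i0) *: e.
pose r (y : 'rV[R]_k) := y + (Num.sqrt (y ord0 i0) - y ord0 i0) *: e.
have Sr y : S (r y) = sqclamp y.
  rewrite /S /r /sqclamp !mxE !eqxx mulr1 -addrA -scalerDl; congr (_ + _ *: _).
  by ring.
have sS : smooth_on setT (g \o S).
  apply: hg; first exact: openT.
    apply: smooth_onD; [exact: openT|exact: (smooth_on_id openT)|].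
    apply: smooth_on_scale; [exact: openT| |exact: (smooth_on_cst _ openT)].
    apply: smooth_onB; [exact: openT|apply: smooth_onX; first exact: openT|];
      exact: (smooth_on_coord _ openT).
  by move=> y _; rewrite /S !mxE !eqxx mulr1 addrCA subrr addr0 sqr_ge0.
have -> : g \o sqclamp = (g \o S) \o r by apply/funext => y /=; rewrite Sr.
have cs : {for x, continuous (fun y : 'rV[R]_k => Num.sqrt (y ord0 i0))}.
  apply: (@continuous_comp _ _ _ (fun y : 'rV[R]_k => y ord0 i0) Num.sqrt).
    exact: coord_continuous.
  exact: sqrt_continuous.
have cr : {for x, continuous r}.
  apply: (@continuousD _ _ _ id (fun y => (Num.sqrt (y ord0 i0) - y ord0 i0) *: e)).
    exact: cvg_id.
  apply: continuousZr_tmp; apply: continuousB; first exact: cs.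
  exact: coord_continuous.
by apply: (continuous_comp cr); exact: (smooth_on_continuous sS I).
Qed.

(** The dilations leave every bounded set, but only in the normal direction, where [g] vanishes from
    1 on. All other points lie in one compact set, which makes the bound independent of [j]. *)
Lemma hsmooth_bounded g (M : R) : hsmooth i0 g ->
  (forall y, 1 <= y ord0 i0 -> g y = 0) ->
  exists B, forall x j, `|x| <= M -> `|g (sqclamp (dilate j x))| <= B.
Proof.
move=> hg g1; have cg := hsmooth_continuous hg.
pose K := [set y : 'rV[R]_k | `|y| <= 2 * M + 1].
have cK : compact K.
  apply: bounded_closed_compact.
    exists (2 * M + 1); split; first exact: num_real.
    by move=> t tM y /= /le_trans; apply; exact: ltW.
  apply: (closed_comp (D := [set t : R | t <= 2 * M + 1])) => [y _|]; last exact: closed_le.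
  exact: norm_continuous.
have [K0|nK0] := pselect (K !=set0); last first.
  exists 0 => x j xM; exfalso; apply: nK0; exists 0; rewrite /K /= normr0.
  by have := le_trans (normr_ge0 _) xM; lra.
have cn : continuous (fun y => `|g (sqclamp y)|).
  by move=> y; apply: (continuous_comp (cg y)); exact: norm_continuous.
have [c cKc cmax] := compact_EVT_max K0 cK (continuous_subspaceT cn).
exists `|g (sqclamp c)| => x j xM.
set y := dilate j x.
have M0 : 0 <= M by exact: le_trans xM.
have py : `|proj y| <= 2 * M.
  by rewrite proj_dilate (le_trans (norm_proj _))// ler_wpM2l.
rewrite sqclampE; case: ifPn => y0.
  have [y1|y1] := leP 1 (y ord0 i0); first by rewrite g1// normr0.
  have Ky : K y.
    rewrite /K /= -[y](subrK (y ord0 i0 *: e)) (le_trans (ler_normD _ _))// lerD//.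
    rewrite normrZ ger0_norm// -[leRHS]mulr1 ler_pM// ?(ltW y1)// norm_delta_mx//.
  by have := cmax y (mem_set Ky); rewrite sqclamp_ge0.
have Ky : K (proj y) by rewrite /K /=; lra.
have := cmax (proj y) (mem_set Ky).
by rewrite sqclamp_ge0// proj_i0.
Qed.

(** A normal derivative of a term pulls out a factor [- (8 ^+ j)]; the index [i] counts these
    factors, so that derivatives of extensions are combinations of extensions. *)
Definition seeley_ext (i : nat) (g : 'rV[R]_k -> R) (x : 'rV[R]_k) : R :=
  if 0 <= x ord0 i0 then g x else
  limn (series (fun j => a j * (- (8 ^+ j)) ^+ i * g (dilate j x))).

Lemma seeley_ext_ge0 i g x : 0 <= x ord0 i0 -> seeley_ext i g x = g x.
Proof. by rewrite /seeley_ext => ->. Qed.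

(** Clamping makes each term continuous everywhere, also where [dilate j x] leaves the half space
    and [g] is arbitrary. *)
Let term i g j x := a j * (- (8 ^+ j)) ^+ i * g (sqclamp (dilate j x)).

Lemma seeley_term_bound i g M : hsmooth i0 g ->
  (forall y, 1 <= y ord0 i0 -> g y = 0) ->
  exists B, forall x j, `|x| <= M -> `|term i g j x| <= B / 2 ^+ j.
Proof.
move=> hg g1; have [B HB] := hsmooth_bounded M hg g1; have [C HC] := a_bound i.
exists (C * B) => x j xM.
rewrite /term normrM mulrAC ler_pM//; last exact: HB.
have := HC j; rewrite !normrM !normrX normrN.
by rewrite normrX.
Qed.

Lemma series_tail_bound (u : R^nat) C N : (forall j, `|u j| <= C / 2 ^+ j) ->
  `|limn (series u) - series u N| <= 2 * C / 2 ^+ N.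
Proof.
move=> uC; have cu := cvg_series_bound uC.
have C0 : 0 <= C by have := le_trans (normr_ge0 _) (uC 0%N); rewrite expr0 divr1.
have H n : `|series u (N + n)%N - series u N| <= 2 * C / 2 ^+ N - 2 * C / 2 ^+ (N + n).
  elim: n => [|n IH]; first by rewrite addn0 !subrr normr0.
  rewrite addnS [series u (N + n).+1]/series /= big_nat_recr//= -/(series u (N + n)).
  rewrite addrAC (le_trans (ler_normD _ _))// (le_trans (lerD IH (uC _)))//.
  rewrite exprS invfM; set h := 2 ^- (N + n).
  by rewrite le_eqVlt; apply/orP; left; apply/eqP; field.
have c1 : `|series u (n + N)%N - series u N| @[n --> \oo] -->
    `|limn (series u) - series u N|.
  apply: cvg_norm; apply: cvgB; last exact: cvg_cst.
  by rewrite (cvg_shiftn N (series u)).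
rewrite -(cvg_lim _ c1)//; apply: limr_le; first by apply/cvg_ex; eexists; exact: c1.
near=> n; rewrite addnC (le_trans (H n))// gerBl divr_ge0 ?mulr_ge0// exprn_ge0//.
Unshelve. all: by end_near. Qed.

(** The extension equals g(clamp x) - g(proj x) + L x, where L is the clamped series: it converges
    uniformly on bounded sets, so L is continuous. On the half space all clamped dilates are proj x,
    and the moment condition gives L x = g(proj x). No separate study of the boundary remains. *)
Lemma seeley_ext_continuous i g : hsmooth i0 g ->
  (forall y, 1 <= y ord0 i0 -> g y = 0) -> continuous (seeley_ext i g).
Proof.
move=> hg g1.
have cg := hsmooth_continuous hg.
have cl j : continuous (dilate j).
  have s : smooth_on setT (dilate j).
    rewrite /dilate.
    have -> : (fun x : 'rV[R]_k => x - ((1 + 8 ^+ j) * x ord0 i0) *: e) =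
        (fun x => x + (- (1 + 8 ^+ j) * x ord0 i0) *: e).
      by apply/funext => x; rewrite mulNr scaleNr.
    apply: smooth_onD; [exact: openT|exact: (smooth_on_id openT)|].
    apply: smooth_on_scale; [exact: openT| |exact: (smooth_on_cst _ openT)].
    by apply: smooth_onM; [exact: openT|exact: (smooth_on_cst _ openT)|exact: (smooth_on_coord _ openT)].
  by move=> x; exact: (smooth_on_continuous s I).
have cproj : continuous proj.
  have s : smooth_on setT proj.
    rewrite /proj.
    have -> : (fun x : 'rV[R]_k => x - x ord0 i0 *: e) =
        (fun x => x + (-1 * x ord0 i0) *: e).
      by apply/funext => x; rewrite mulN1r scaleNr.
    apply: smooth_onD; [exact: openT|exact: (smooth_on_id openT)|].
    apply: smooth_on_scale; [exact: openT| |exact: (smooth_on_cst _ openT)].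
    by apply: smooth_onM; [exact: openT|exact: (smooth_on_cst _ openT)|exact: (smooth_on_coord _ openT)].
  by move=> x; exact: (smooth_on_continuous s I).
pose L x := limn (series (fun j => term i g j x)).
have cterm j : continuous (term i g j).
  move=> x; apply: (@continuousM _ _ (fun=> a j * (- (8 ^+ j)) ^+ i)
    (fun y => g (sqclamp (dilate j y)))); first exact: cst_continuous.
  exact: (continuous_comp (cl j x) (cg _)).
have cL : continuous L.
  move=> x; suff : L y @[y --> x] --> L x by [].
  apply/(@cvgrPdist_le _ _ _ _ (nbhs_filter x)) => eps eps0.
  have [B HB] := seeley_term_bound i (`|x| + 1) hg g1.
  have B0 : 0 <= B.
    have := le_trans (normr_ge0 _) (HB x 0%N _).
    by rewrite expr0 divr1; apply; rewrite lerDl.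
  have [N HN] : exists N : nat, 2 * B / 2 ^+ N <= eps / 3.
    have c0 : 2 * B / 2 ^+ n @[n --> \oo] --> (0 : R).
      rewrite -[0 : R](mulr0 (2 * B)); apply: cvgMl_tmp.
      under eq_fun do rewrite -exprVn.
      by apply: cvg_expr; rewrite ger0_norm// invf_lt1// ltr1n.
    have e3 : 0 < eps / 3 by rewrite divr_gt0.
    have /cvgr0_norm_le /(_ _ e3) [N _ /(_ N (leqnn N))] := c0.
    by move=> /= /ler_normlW; exists N.
  have cN : {for x, continuous (fun y => series (fun j => term i g j y) N)}.
    rewrite /series /=; elim: N {HN} => [|N IH].
      have -> : (fun y => \sum_(0 <= j < 0) term i g j y) = cst 0.
        by apply/funext => y; rewrite big_geq.
      exact: cst_continuous.
    have -> : (fun y => \sum_(0 <= j < N.+1) term i g j y) =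
        (fun y => \sum_(0 <= j < N) term i g j y) \+ term i g N.
      by apply/funext => y; rewrite big_nat_recr.
    exact: continuousD IH (cterm N x).
  have e3 : 0 < eps / 3 by rewrite divr_gt0.
  have /cvgrPdist_le /(_ _ e3) cN' := cN.
  have b1 : \forall y \near x, `|y| <= `|x| + 1.
    have /nbhs_ballP : nbhs_ball x [set y | `|y| <= `|x| + 1].
      exists 1; first exact: ltr01.
      move=> y; rewrite -ball_normE /ball_ /= => xy.
      have -> : y = x - (x - y) by rewrite subKr.
      by rewrite (le_trans (ler_normB _ _))// lerD2l ltW.
    by [].
  near=> y.
  have t1 : `|L x - series (fun j => term i g j x) N| <= eps / 3.
    apply: le_trans HN; apply: series_tail_bound => j; apply: HB.
    by rewrite lerDl.
  have t2 : `|L y - series (fun j => term i g j y) N| <= eps / 3.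
    apply: le_trans HN; apply: series_tail_bound => j; apply: HB.
    by near: y.
  have t3 : `|series (fun j => term i g j x) N - series (fun j => term i g j y) N| <= eps / 3.
    by near: y.
  have tri (p q r s : R) : p - s = (p - q) + (q - r) - (s - r) by ring.
  rewrite (tri (L x) (series (fun j => term i g j x) N)
    (series (fun j => term i g j y) N) (L y)).
  rewrite (le_trans (ler_normB _ _))// (le_trans (lerD (ler_normD _ _) (lexx _)))//.
  by lra.
have -> : seeley_ext i g = (fun x => g (sqclamp x) - g (sqclamp (proj x)) + L x).
  apply/funext => x; rewrite /seeley_ext; case: ifPn => x0.
    have -> : L x = g (sqclamp (proj x)).
      rewrite /L.
      have -> : (fun j => term i g j x) =
          (g (sqclamp (proj x))) *: (fun j => a j * (- (8 ^+ j)) ^+ i).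
        apply/funext => j; rewrite /term sqclamp_le0; last first.
          by rewrite dilate_i0 oppr_le0 mulr_ge0// exprn_ge0.
        by rewrite proj_dilate [sqclamp (proj x)]sqclamp_ge0 ?proj_i0// mulrC.
      have am := @a_moment i.
      have cam : cvgn (series (fun j => a j * (- (8 ^+ j)) ^+ i)).
        by apply/cvg_ex; eexists; exact: am.
      rewrite (lim_seriesZ _ cam); have -> := cvg_lim (@Rhausdorff R) am.
      by rewrite [_ *: 1]mulr1.
    by rewrite subrK sqclamp_ge0.
  have x0' : x ord0 i0 <= 0 by rewrite ltW// ltNge.
  rewrite (sqclamp_le0 x0') [sqclamp (proj x)]sqclamp_ge0 ?proj_i0// subrr add0r.
  rewrite /L; congr (limn (series _)); apply/funext => j; rewrite /term sqclamp_ge0//.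
  by rewrite dilate_i0 -mulrN mulr_ge0 ?exprn_ge0// oppr_ge0.
move=> x; apply: (@continuousD _ _ _ (fun x => g (sqclamp x) - g (sqclamp (proj x))) L);
  last exact: cL.
apply: (@continuousB _ _ _ (g \o sqclamp) (fun x => g (sqclamp (proj x)))).
  exact: cg.
exact: (continuous_comp (cproj x) (cg _)).
Unshelve. all: by end_near. Qed.

Lemma tangential_eq0 w g : w ord0 i0 = 0 ->
  (forall y, 1 <= y ord0 i0 -> g y = 0) ->
  forall y, 1 <= y ord0 i0 -> tangential w g y = 0.
Proof.
move=> w0 g1 y y1; rewrite /tangential derive1n1.
have -> : (fun z : R => g (y + z ^+ 1 *: w)) = cst 0.
  by apply/funext => z; rewrite g1// !mxE w0 mulr0 addr0.
exact: derive1_cst.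
Qed.

Lemma normald_eq0 g : (forall y, 1 <= y ord0 i0 -> g y = 0) ->
  forall y, 1 <= y ord0 i0 -> normald i0 g y = 0.
Proof.
move=> g1 y y1; rewrite /normald derive1nS derive1n1.
have -> : (fun z : R => g (y + z ^+ 2 *: delta_mx ord0 i0)) = cst 0.
  apply/funext => z; rewrite g1// !mxE !eqxx mulr1 (le_trans y1)// lerDl.
  exact: sqr_ge0.
have -> : derive1 (cst (0 : R)) = cst (0 : R) by apply/funext => z; exact: derive1_cst.
by rewrite derive1_cst mulr0.
Qed.

(** At depth at least [d], the points [dilate j x] with 8^j d >= 1 lie where [g] vanishes. So off
    the boundary the series is locally a finite sum and is differentiated termwise. *)
Lemma seeley_ext_lt0 i g N d x : (forall y, 1 <= y ord0 i0 -> g y = 0) ->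
  0 < d -> 1 <= 8 ^+ N * d -> x ord0 i0 <= - d ->
  seeley_ext i g x = \sum_(0 <= j < N) a j * (- (8 ^+ j)) ^+ i * g (dilate j x).
Proof.
move=> g1 d0 Nd xd; rewrite /seeley_ext ifF; last by apply/negbTE; rewrite -ltNge; lra.
apply/lim_near_cst => //; near=> n.
have Nn : (N <= n)%N by near: n; exact: nbhs_infty_ge.
rewrite /series /= (big_cat_nat (n := N))//= [X in _ + X]big_nat [X in _ + X]big1 ?addr0// => j /andP[Nj _].
rewrite g1 ?mulr0// dilate_i0 -mulrN (le_trans Nd)//.
apply: ler_pM; [exact: exprn_ge0|exact: ltW| |by lra].
by rewrite ler_weXn2l// ler1n.
Unshelve. all: by end_near. Qed.

Let is_derive_dilate g j x v : hsmooth i0 g -> x ord0 i0 < 0 ->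
  is_derive x v (g \o dilate j)
    (tangential (proj v) g (dilate j x)
     - 8 ^+ j * v ord0 i0 * normald i0 g (dilate j x)).
Proof.
move=> hg x0.
have y0 : halfopen i0 (dilate j x).
  by rewrite /halfopen /= dilate_i0 -mulrN mulr_gt0 ?exprn_gt0// oppr_gt0.
have [d dE] := is_derive_halfopen (dilate j v) hg y0.
have E : (fun h : R => h^-1 *: (((g \o dilate j) \o shift x) (h *: v) - (g \o dilate j) x)) =
  (fun h : R => h^-1 *: ((g \o shift (dilate j x)) (h *: dilate j v) - g (dilate j x))).
  by apply/funext => h /=; rewrite dilateD.
split; first by rewrite /derivable E.
rewrite /derive E -/(derive g (dilate j x) (dilate j v)) dE -/e.
by rewrite -/(proj (dilate j v)) proj_dilate dilate_i0 mulNr.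
Qed.

Lemma is_derive_seeley_ext i g x v : hsmooth i0 g ->
  (forall y, 1 <= y ord0 i0 -> g y = 0) -> x ord0 i0 != 0 ->
  is_derive x v (seeley_ext i g)
    (seeley_ext i (tangential (proj v) g) x
     + v ord0 i0 * seeley_ext i.+1 (normald i0 g) x).
Proof.
move=> hg g1; case: ltgtP => // x0 _; last first.
  rewrite !seeley_ext_ge0 ?(ltW x0)//.
  have nx : nbhs x (halfopen i0).
    by apply: open_nbhs_nbhs; split; [exact: open_halfopen|exact: x0].
  apply: near_eq_is_derive (is_derive_halfopen v hg x0).
  by apply: filterS nx => y /ltW y0; rewrite seeley_ext_ge0.
pose d := - x ord0 i0 / 2.
have d0 : 0 < d by rewrite divr_gt0// oppr_gt0.
have [N Nd] : exists N, 1 <= 8 ^+ N * d.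
  have c0 : 8 ^- n @[n --> \oo] --> (0 : R).
    under eq_fun do rewrite -exprVn.
    by apply: cvg_expr; rewrite ger0_norm// invf_lt1// ltr1n.
  have /cvgr0_norm_le /(_ _ d0) [N _ /(_ N (leqnn N))] := c0.
  move=> /= /ler_normlW; rewrite -[_ ^-1]mul1r ler_pdivrMr ?exprn_gt0// mulrC.
  by exists N.
have xd : x ord0 i0 <= - d by rewrite /d; lra.
have t1 := tangential_eq0 (proj_i0 v) g1.
have n1 := normald_eq0 g1.
rewrite (seeley_ext_lt0 i t1 d0 Nd xd) (seeley_ext_lt0 i.+1 n1 d0 Nd xd).
have D : is_derive x v
    (fun y => \sum_(0 <= j < N) a j * (- (8 ^+ j)) ^+ i * g (dilate j y))
    (\sum_(0 <= j < N) a j * (- (8 ^+ j)) ^+ i *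
      (tangential (proj v) g (dilate j x)
     - 8 ^+ j * v ord0 i0 * normald i0 g (dilate j x))).
  elim: (N) => [|n IH].
    have -> : (fun y => \sum_(0 <= j < 0) a j * (- (8 ^+ j)) ^+ i * g (dilate j y)) = cst 0.
      by apply/funext => y; rewrite big_geq.
    by rewrite big_geq//; exact: is_derive_cst.
  have -> : (fun y => \sum_(0 <= j < n.+1) a j * (- (8 ^+ j)) ^+ i * g (dilate j y)) =
     (fun y => \sum_(0 <= j < n) a j * (- (8 ^+ j)) ^+ i * g (dilate j y)) +
     (a n * (- (8 ^+ n)) ^+ i) *: (g \o dilate n).
    by apply/funext => y; rewrite big_nat_recr.
  rewrite big_nat_recr; last exact: leq0n.
  exact: (is_deriveD IH (is_deriveZ _ (is_derive_dilate n v hg x0))).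
have nx : nbhs x [set y : 'rV[R]_k | y ord0 i0 < - d].
  apply: open_nbhs_nbhs; split; last by rewrite /= /d; lra.
  by apply: (open_comp (D := [set t : R | t < - d])) => [y _|]; [exact: coord_continuous|exact: open_lt].
apply: near_eq_is_derive (is_derive_eq D _).
  by apply: filterS nx => y /ltW yd; rewrite (seeley_ext_lt0 i g1 d0 Nd).
rewrite mulr_sumr -big_split /=; apply: eq_bigr => j _.
by rewrite exprSr; ring.
Qed.

(** Stable under derivatives off the boundary by [is_derive_seeley_ext], and across it because the
    extension and its candidate derivative are both continuous. *)
Inductive seeley_class : ('rV[R]_k -> R) -> Prop :=
| seeley_class_ext i g : hsmooth i0 g ->
    (forall y, 1 <= y ord0 i0 -> g y = 0) -> seeley_class (seeley_ext i g)
| seeley_class_lin (f g : 'rV[R]_k -> R) c :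
    seeley_class f -> seeley_class g -> seeley_class (f + c *: g).

Lemma smooth_seeley_ext g : hsmooth i0 g ->
  (forall y, 1 <= y ord0 i0 -> g y = 0) -> smooth_on setT (seeley_ext 0 g).
Proof.
move=> hg g1; apply: (@smooth_on_class _ _ _ _ seeley_class openT).
- move=> f Cf x _; elim: Cf => [i h hh h1|f1 g2 c _ c1 _ c2].
    exact: seeley_ext_continuous.
  apply: continuousD; first exact: c1.
  have -> : c *: g2 = (fun y => c * g2 y) by [].
  by apply: (@continuousM _ _ (fun=> c) g2); [exact: cst_continuous|exact: c2].
- move=> f Cf v; elim: Cf => [i h hh h1|f1 g2 c _ [f' Cf df] _ [g' Cg dg]].
    have ht := hsmooth_tangential (proj_i0 v) hh.
    have hn := hsmooth_normald hh.
    have t1 := tangential_eq0 (proj_i0 v) h1.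
    have n1 := normald_eq0 h1.
    exists (seeley_ext i (tangential (proj v) h) + v ord0 i0 *: seeley_ext i.+1 (normald i0 h)).
      by apply: seeley_class_lin; apply: seeley_class_ext.
    move=> x _; apply: (is_derive_across_hyperplane (i0 := i0)).
    - exact: seeley_ext_continuous.
    - move=> y; apply: continuousD; first exact: seeley_ext_continuous.
      apply: (@continuousM _ _ (fun=> v ord0 i0) (seeley_ext i.+1 (normald i0 h))).
        exact: cst_continuous.
      exact: seeley_ext_continuous.
    - by move=> y y0; exact: is_derive_seeley_ext.
  exists (f' + c *: g'); first exact: seeley_class_lin.
  by move=> x _; exact: (is_deriveD (df x I) (is_deriveZ c (dg x I))).
- exact: seeley_class_ext.
Qed.

End SeeleyExtension.

Lemma hsmooth_extension (R : realType) (k : nat) (i0 : 'I_k) (g : 'rV[R]_k -> R) :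
  hsmooth i0 g -> (forall y : 'rV[R]_k, 1 <= y ord0 i0 -> g y = 0) ->
  exists2 f, smooth_on setT f & forall x : 'rV[R]_k, 0 <= x ord0 i0 -> f x = g x.
Proof.
move=> hg g1; have [a [ab am]] := seeley_coefficients R.
exists (seeley_ext i0 a 0 g); first exact: smooth_seeley_ext.
by move=> x x0; rewrite seeley_ext_ge0.
Qed.

(** * Functions smooth on the sphere region extend *)

Section SphereExtension.
Variable R : realType.

Definition sqn n (u : 'rV[R]_n) : R := \sum_(i < n) u ord0 i ^+ 2.

Lemma sqn_ge0 n (u : 'rV[R]_n) : 0 <= sqn u.
Proof. by apply: sumr_ge0 => i _; exact: sqr_ge0. Qed.

Lemma sqnZ n (c : R) (u : 'rV[R]_n) : sqn (c *: u) = c ^+ 2 * sqn u.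
Proof. by rewrite /sqn mulr_sumr; apply: eq_bigr => i _; rewrite mxE exprMn. Qed.

Lemma Sph_sqn n m (p : 'rV[R]_n * 'rV[R]_m) : Sph (n := n) (m := m) p <-> 1 <= sqn p.1.
Proof.
rewrite /Sph /= /enorm -/(sqn p.1) -[X in X <= Num.sqrt _](@sqrtr1 R).
by rewrite ler_sqrt// sqn_ge0.
Qed.

Lemma smooth_on_sqn k (U : set 'rV[R]_k) n (F : 'rV[R]_k -> 'rV[R]_n) : open U ->
  smooth_on U F -> smooth_on U (fun x => sqn (F x)).
Proof.
move=> oU sF; apply: smooth_on_sum; first exact: oU.
move=> i; apply: smooth_onX; first exact: oU.
exact: (rV_smooth_on i oU sF).
Qed.

(** Smoothness for the subset diffeology of [A], phrased with total functions so that no membership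
    proof is carried along. *)
Definition pair_smooth n m (A : set ('rV[R]_n * 'rV[R]_m))
    (g : 'rV[R]_n * 'rV[R]_m -> R) : Prop :=
  forall k (U : set 'rV[R]_k) (P : 'rV[R]_k -> 'rV[R]_n) (Q : 'rV[R]_k -> 'rV[R]_m),
    open U -> smooth_on U P -> smooth_on U Q ->
    (forall x, U x -> A (P x, Q x)) -> smooth_on U (fun x => g (P x, Q x)).

Lemma open_preimage k (U : set 'rV[R]_k) (f : 'rV[R]_k -> R) (D : set R) :
  open U -> open D -> smooth_on U f -> open (U `&` [set x | D (f x)]).
Proof.
move=> oU oD sf; rewrite openE => x [Ux Dx]; apply: filterI.
  exact: open_nbhs_nbhs.
by apply: (smooth_on_continuous sf Ux); exact: open_nbhs_nbhs.
Qed.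

(* t and w parametrize the points (1 + t + |w|^2) / (2 |w|^2) w, which by AM-GM
   lie in the sphere region as soon as 0 <= t, and which are w itself when
   t = |w|^2 - 1. *)
Lemma retract_ge1 (t q : R) : 0 <= t -> 0 < q ->
  1 <= ((1 + t + q) / (2 * q)) ^+ 2 * q.
Proof.
move=> t0 q0; have q1 : q != 0 by rewrite gt_eqF.
have -> : ((1 + t + q) / (2 * q)) ^+ 2 * q = (1 + t + q) ^+ 2 / (4 * q).
  by field; rewrite q1.
rewrite ler_pdivlMr ?mulr_gt0// mul1r.
rewrite (@le_trans _ _ ((1 + q) ^+ 2))//.
  by have := sqr_ge0 (1 - q); lra.
by rewrite lerXn2r ?nnegrE; lra.
Qed.

(** Making t = |u|^2 - 1 an independent variable turns the sphere region into the half space 0 <= t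
    without polar coordinates. [H] is [g] at the point of [retract_ge1], cut off in t as Seeley's
    series requires, and near w = 0, where [cp] is singular. Substituting t = |u|^2 - 1 in its
    extension gives [G] near the boundary. *)
Lemma sphere_extension n m (g : 'rV[R]_n * 'rV[R]_m -> R) :
  pair_smooth (@Sph R n m) g ->
  exists2 G, pair_smooth setT G & forall s, @Sph R n m s -> G s = g s.
Proof.
move=> sg.
pose i0 : 'I_(1 + (n + m)) := lshift (n + m) ord0.
pose wp (y : 'rV[R]_(1 + (n + m))) : 'rV[R]_n := lsubmx (rsubmx y).
pose vp (y : 'rV[R]_(1 + (n + m))) : 'rV[R]_m := rsubmx (rsubmx y).
pose tp (y : 'rV[R]_(1 + (n + m))) : R := y ord0 i0.
pose cp y := (1 + tp y + sqn (wp y)) * (2 * sqn (wp y))^-1.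
(* The first factor is 1 for t <= 1/4 and 0 for t >= 1/2; the second is 0 for |w|^2 <= 1/4 and 1 for
   |w|^2 >= 1/2, hence 1 on the sphere region. *)
pose H y := (1 - smoothstep (4 * tp y - 1)) * smoothstep (4 * sqn (wp y) - 1) *
  g (cp y *: wp y, vp y).
have hH : hsmooth i0 H.
  move=> k U F oU sF F0.
  have st : smooth_on U (fun x => tp (F x)) := rV_smooth_on i0 oU sF.
  have sr : smooth_on U (fun x => rsubmx (F x)).
    by apply: (smooth_on_comp openT oU _ _ sF) => //; exact: smooth_on_rsubmx openT.
  have sw : smooth_on U (fun x => wp (F x)).
    by apply: (smooth_on_comp openT oU _ _ sr) => //; exact: smooth_on_lsubmx openT.
  have sv : smooth_on U (fun x => vp (F x)).
    by apply: (smooth_on_comp openT oU _ _ sr) => //; exact: smooth_on_rsubmx openT.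
  have sq := smooth_on_sqn oU sw.
  have aff (V : set 'rV[R]_k) (f : 'rV[R]_k -> R) : open V -> smooth_on V f ->
      smooth_on V (fun x => smoothstep (4 * f x - 1)).
    move=> oV sf; apply: smooth_on_smoothstep; first exact: oV.
    apply: smooth_onB; [exact: oV| |exact: smooth_on_cst].
    by apply: smooth_onM; [exact: oV|exact: smooth_on_cst|exact: sf].
  apply: smooth_on_local => x Ux.
  have [x8|x8] := leP (sqn (wp (F x))) 8^-1.
    exists (fun=> 0), (U `&` [set x | sqn (wp (F x)) < 4^-1]).
    have oV := open_preimage oU (@open_lt R 4^-1) sq.
    split; [exact: oV|by split=> //=; lra| |exact: (smooth_on_cst _ oV)].
    move=> y [_ /= y4]; rewrite /H /= (@smoothstep_le0 _ (4 * sqn _ - 1)); last by lra.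
    by rewrite mulr0 mul0r.
  exists (H \o F), (U `&` [set x | 8^-1 < sqn (wp (F x))]).
  have oV := open_preimage oU (@open_gt R 8^-1) sq.
  have VU : U `&` [set x | 8^-1 < sqn (wp (F x))] `<=` U by move=> ? [].
  split; [exact: oV|by []|by []|].
  have {}st := smooth_on_sub VU st. have {}sw := smooth_on_sub VU sw.
  have {}sv := smooth_on_sub VU sv. have {}sq := smooth_on_sub VU sq.
  apply: smooth_onM; first exact: oV.
    apply: smooth_onM; [exact: oV| |exact: aff oV sq].
    apply: smooth_onB; [exact: oV|exact: smooth_on_cst|exact: aff oV st].
  apply: (sg _ _ (fun x => cp (F x) *: wp (F x)) (fun x => vp (F x)) oV _ sv).
    apply: smooth_on_scale; [exact: oV| |exact: sw].
    apply: smooth_onM; first exact: oV.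
      apply: smooth_onD; [exact: oV| |exact: sq].
      by apply: smooth_onD; [exact: oV|exact: smooth_on_cst|exact: st].
    apply: smooth_onV; first exact: oV.
      by move=> y [_ /= y8]; rewrite mulf_neq0// gt_eqF//; lra.
    by apply: smooth_onM; [exact: oV|exact: smooth_on_cst|exact: sq].
  move=> y [Uy /= y8]; apply/Sph_sqn; rewrite /= sqnZ; apply: retract_ge1.
    exact: F0.
  by lra.
have H1 (y : 'rV[R]_(1 + (n + m))) : 1 <= y ord0 i0 -> H y = 0.
  move=> y1; rewrite /H (@smoothstep_ge1 _ (4 * tp y - 1)); last by rewrite /tp; lra.
  by rewrite subrr !mul0r.
have [f sf fH] := hsmooth_extension hH H1.
pose emb (p : 'rV[R]_n * 'rV[R]_m) : 'rV[R]_(1 + (n + m)) :=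
  row_mx (sqn p.1 - 1)%:M (row_mx p.1 p.2).
(* The second summand gives back what the cutoff in t removed. It vanishes for |u|^2 <= 5/4, so it
   is smooth although [g] is arbitrary for |u| < 1. *)
pose G p := f (emb p) + smoothstep (4 * (sqn p.1 - 1) - 1) * g p.
exists G => [k U P Q oU sP sQ _|s].
  have sq := smooth_on_sqn oU sP.
  have sq1 : smooth_on U (fun x => sqn (P x) - 1).
    by apply: smooth_onB; [exact: oU|exact: sq|exact: smooth_on_cst].
  apply: smooth_onD; first exact: oU.
    apply: (smooth_on_comp_real openT oU _ sf (F := fun x => emb (P x, Q x))) => //.
    apply: smooth_on_row_mx; first exact: oU.
      by apply: smooth_on_scalar_mx; [exact: oU|exact: sq1].
    by apply: smooth_on_row_mx; [exact: oU|exact: sP|exact: sQ].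
  apply: smooth_on_local => x Ux.
  have [x8|x8] := leP (sqn (P x)) (9 / 8).
    exists (fun=> 0), (U `&` [set x | sqn (P x) < 5 / 4]).
    have oV := open_preimage oU (@open_lt R (5 / 4)) sq.
    split; [exact: oV|by split=> //=; lra| |exact: (smooth_on_cst _ oV)].
    by move=> y [_ /= y4]; rewrite smoothstep_le0 ?mul0r//; lra.
  exists (fun x => smoothstep (4 * (sqn (P x) - 1) - 1) * g (P x, Q x)),
    (U `&` [set x | 1 < sqn (P x)]).
  have oV := open_preimage oU (@open_gt R 1) sq.
  have VU : U `&` [set x | 1 < sqn (P x)] `<=` U by move=> ? [].
  split; [exact: oV|by split=> //=; lra|by []|].
  apply: smooth_onM; first exact: oV.
    apply: smooth_on_smoothstep; first exact: oV.
    apply: smooth_onB; [exact: oV| |exact: smooth_on_cst].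
    apply: smooth_onM; [exact: oV|exact: smooth_on_cst|exact: (smooth_on_sub VU sq1)].
  apply: (sg _ _ P Q oV (smooth_on_sub VU sP) (smooth_on_sub VU sQ)).
  by move=> y [_ /= y1]; apply/Sph_sqn; exact: ltW.
case: s => u v /Sph_sqn /= u1.
have tE : tp (emb (u, v)) = sqn u - 1.
  by rewrite /tp /emb /= row_mxEl mxE eqxx mulr1n.
have wE : wp (emb (u, v)) = u by rewrite /wp /emb /= row_mxKr row_mxKl.
have vE : vp (emb (u, v)) = v by rewrite /vp /emb /= row_mxKr row_mxKr.
have q0 : sqn u != 0 by rewrite gt_eqF//; lra.
have cE : cp (emb (u, v)) = 1 by rewrite /cp tE wE; field.
rewrite /G /= fH; last by rewrite -/(tp (emb (u, v))) tE; lra.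
rewrite /H tE wE vE cE scale1r (@smoothstep_ge1 _ (4 * sqn u - 1)); last by lra.
by rewrite mulr1; ring.
Qed.

End SphereExtension.

(** * Plots and functions on the skeleta *)

Section SubsetPlots.
Variable R : realType.

Lemma exist_eq (T : Type) (P : T -> Prop) (x y : {z | P z}) :
  proj1_sig x = proj1_sig y -> x = y.
Proof.
by case: x y => [x hx] [y hy] /= xy; subst y; rewrite (Prop_irrelevance hx hy).
Qed.

Lemma extend0E (k : nat) (V : zmodType) (U : set 'rV[R]_k) (P : {x | U x} -> V)
  (x : {x | U x}) : extend0 P (proj1_sig x) = P x.
Proof.
rewrite /extend0; case: pselect => [h|]; last by have := proj2_sig x.
by congr P; exact: exist_eq.
Qed.

Lemma smooth_subP k (V : normedModType R) (U : set 'rV[R]_k) (P : {x | U x} -> V)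
    (f : 'rV[R]_k -> V) : open U -> (forall x, P x = f (proj1_sig x)) ->
  smooth_sub P <-> smooth_on U f.
Proof.
move=> oU Pf; rewrite /smooth_sub; split; apply: (eq_smooth_on oU) => x Ux.
  by have := extend0E P (exist _ x Ux); rewrite Pf.
by have := extend0E P (exist _ x Ux); rewrite Pf.
Qed.

Lemma smooth_sub_prestr k (V : normedModType R) (U W : set 'rV[R]_k) (hWU : W `<=` U)
    (P : {x | U x} -> V) : open W -> smooth_sub P -> smooth_sub (prestr hWU P).
Proof.
move=> oW sP; apply/(smooth_subP (f := extend0 P) oW); last exact: smooth_on_sub hWU sP.
by case=> x Wx; rewrite /prestr -(extend0E P).
Qed.

Lemma smooth_sub_local k (V : normedModType R) (U : set 'rV[R]_k)
    (P : {x | U x} -> V) :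
  (forall x : {x | U x}, exists (W : set 'rV[R]_k) (hWU : W `<=` U),
     [/\ open W, W (proj1_sig x) & smooth_sub (prestr hWU P)]) -> smooth_sub P.
Proof.
move=> H; apply: smooth_on_local => x Ux.
have [W [hWU [oW Wx sW]]] := H (exist _ x Ux).
exists (extend0 (prestr hWU P)), W; split; [exact: oW|exact: Wx| |exact: sW].
move=> y Wy.
rewrite (extend0E (prestr hWU P) (exist _ y Wy)) /prestr /=.
exact: (extend0E P (exist _ y (hWU y Wy))).
Qed.

Lemma pair_smooth_eplot n m (A : set ('rV[R]_n * 'rV[R]_m)) g k (U : set 'rV[R]_k)
    (P : {x | U x} -> 'rV[R]_n * 'rV[R]_m) :
  pair_smooth A g -> eplot P -> (forall x, A (P x)) -> smooth_sub (g \o P).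
Proof.
move=> sg [oU [s1 s2]] hA.
have E x : P x = (extend0 (fun x => (P x).1) (proj1_sig x),
                  extend0 (fun x => (P x).2) (proj1_sig x)).
  by rewrite !extend0E -surjective_pairing.
apply/(smooth_subP (f := fun x => g (extend0 (fun x => (P x).1) x,
   extend0 (fun x => (P x).2) x)) oU).
  by move=> x /=; rewrite {1}E.
apply: sg oU s1 s2 _ => x Ux.
by have := hA (exist _ x Ux); rewrite E.
Qed.

Lemma eplot_pair n m k (U : set 'rV[R]_k) (P : 'rV[R]_k -> 'rV[R]_n)
    (Q : 'rV[R]_k -> 'rV[R]_m) : open U -> smooth_on U P -> smooth_on U Q ->
  eplot (fun x : {x | U x} => (P (proj1_sig x), Q (proj1_sig x))).
Proof.
move=> oU sP sQ; split; [exact: oU|split].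
  by apply/(smooth_subP (f := P) oU); [|exact: sP].
by apply/(smooth_subP (f := Q) oU); [|exact: sQ].
Qed.

Lemma dplot_prestr (Y : dspace R) k (U W : set 'rV[R]_k) (hWU : W `<=` U)
    (P : {x | U x} -> Y) : open W -> dplot P -> dplot (prestr hWU P).
Proof. by move=> oW dP; apply: (plot_smooth dP hWU oW); exact: smooth_on_id. Qed.

(** Every map into this space is smooth, so testing the pushout against it yields the universal
    property of the underlying sets. *)
Definition indiscrete_diffeology (T : Type) : diffeology R T.
Proof.
by exists (fun k (U : set 'rV[R]_k) (_ : {x | U x} -> T) => open U).
Defined.

Definition indiscrete (T : Type) : dspace R := DSpace (indiscrete_diffeology T).

End SubsetPlots.

(** * Local lifts and gluing on the pushouts *)

Section Skeleta.
Variables (R : realType) (X : dspace R) (C : fatCW X).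

Let incl N (x : {x | skel C N x}) : {x | skel C N.+1 x} :=
  exist _ (proj1_sig x) (@skelS _ _ C N _ (proj2_sig x)).

(** Two maps to the indiscrete [bool], the constant [true] and membership in the union of the two
    images, agree on [skel C N] and on the cells; uniqueness makes them equal. *)
Lemma skelS_cover N (y : X) : skel C N.+1 y ->
  skel C N y \/ exists (j : cells C N) d, y = proj1_sig (@chr _ _ C N j d).
Proof.
move=> hy.
pose B := indiscrete R bool.
have [|||u [_ _ _ H]] := @pushout _ _ C N B (fun=> true) (fun _ _ => true).
- by move=> k U P hA /plot_open.
- by move=> j k U P hA [].
- by [].
pose v (y : {x | skel C N.+1 x}) := `[< skel C N (proj1_sig y) \/
  exists (j : cells C N) d, proj1_sig y = proj1_sig (@chr _ _ C N j d) >].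
have v1 := H v; have v2 := H (fun=> true).
suff /asboolP : v (exist _ y hy) by [].
rewrite v1.
- rewrite -v2//.
  + by move=> k U P hA /plot_open.
- by move=> k U P hA /plot_open.
- by move=> x; apply/asboolP; left => /=; exact: proj2_sig.
- by move=> j d; apply/asboolP; right; exists j, d.
Qed.

(* Plots of the explicit pushout; by the universal property they are the plots of
   skel C N.+1. Constant plots are listed because joint surjectivity of the two
   maps into the pushout is not yet used. *)
Definition pushout_plot N k (U : set 'rV[R]_k) (P : {x | U x} -> {x | skel C N.+1 x}) : Prop :=
  open U /\ forall x : {x | U x}, exists (V : set 'rV[R]_k) (hVU : V `<=` U),
  [/\ open V, V (proj1_sig x) &
   [\/ (forall y, skel C N (proj1_sig (prestr hVU P y))) /\
       @dplot _ X _ V (fun y => proj1_sig (prestr hVU P y)),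
       exists (j : cells C N) (p : {y | V y} -> 'rV[R]_N * 'rV[R]_(cdim j))
         (hD : forall y, @Disk R N (cdim j) (p y)),
         eplot p /\ forall y, prestr hVU P y = chr (exist _ (p y) (hD y)) |
       exists z, forall y, prestr hVU P y = z]].

Lemma pushout_plot_smooth N k (U : set 'rV[R]_k) (P : {x | U x} -> {x | skel C N.+1 x}) :
  pushout_plot P -> forall k' (V : set 'rV[R]_k') (F : 'rV[R]_k' -> 'rV[R]_k)
      (hF : forall y, V y -> U (F y)),
    open V -> smooth_on V F -> pushout_plot (Defs.pcomp hF P).
Proof.
move=> [oU lP] k' V F hF oV sF; split=> // -[x Vx].
have [W [hWU [oW Wx H]]] := lP (exist _ (F x) (hF x Vx)).
pose V' := V `&` [set y | W (F y)].
have V'V : V' `<=` V by move=> y [].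
have V'W y : V' y -> W (F y) by move=> [].
have oV' : open V'.
  rewrite openE => y [Vy Wy]; apply: filterI; first exact: open_nbhs_nbhs.
  by apply: (smooth_on_continuous sF Vy); exact: open_nbhs_nbhs.
have E y : prestr V'V (Defs.pcomp hF P) y = prestr hWU P (exist _ (F (proj1_sig y)) (V'W _ (proj2_sig y))).
  by rewrite /prestr /Defs.pcomp; congr P; exact: exist_eq.
have sF' := smooth_on_sub V'V sF.
exists V', V'V; split=> //; case: H => [[H1 H2]|[j [p [hD [ep H]]]]|[z H]].
- constructor 1; split=> [y|]; first by rewrite E.
  have -> : (fun y => proj1_sig (prestr V'V (Defs.pcomp hF P) y)) =
      Defs.pcomp V'W (fun y => proj1_sig (prestr hWU P y)).
    by apply/funext => y; rewrite E.
  exact: (plot_smooth H2 V'W oV' sF').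
- constructor 2; exists j, (Defs.pcomp V'W p), (fun y => hD _); split.
    have [_ [s1 s2]] := ep; split; [exact: oV'|split].
      apply/(smooth_subP (f := extend0 (fun x => (p x).1) \o F) oV').
        move=> y; symmetry.
        exact: (extend0E (fun x => (p x).1) (exist _ (F (proj1_sig y)) (V'W _ (proj2_sig y)))).
      exact: (smooth_on_comp oW oV' V'W s1 sF').
    apply/(smooth_subP (f := extend0 (fun x => (p x).2) \o F) oV').
      move=> y; symmetry.
      exact: (extend0E (fun x => (p x).2) (exist _ (F (proj1_sig y)) (V'W _ (proj2_sig y)))).
    exact: (smooth_on_comp oW oV' V'W s2 sF').
  by move=> y; rewrite E H.
- by constructor 3; exists z => y; rewrite E H.
Qed.

Definition pushout_diffeology N : diffeology R {x | skel C N.+1 x}.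
Proof.
exists (@pushout_plot N).
- by move=> k U P [].
- move=> k U y oU; split=> // x; exists U, (@subset_refl _ U); split=> //; last first.
    by constructor 3; exists y.
  exact: proj2_sig.
- move=> k U P oU lP; split=> // x.
  have [V [hVU [oV [Vx [_ H]]]]] := lP x.
  have [W [hWV [oW Wx {}H]]] := H (exist _ (proj1_sig x) Vx).
  by exists W, (fun y Wy => hVU y (hWV y Wy)).
- exact: pushout_plot_smooth.
Defined.

(** The universal property gives a smooth map [u] to the explicit pushout. As a map of sets it is
    the identity, so a plot with values in [skel C N.+1] is a plot of the explicit pushout;
    [skelS_cover] then sorts the constant plots. *)
Lemma skelS_lift N k (U : set 'rV[R]_k) (Q : {x | U x} -> X) : dplot Q ->
  (forall x, skel C N.+1 (Q x)) -> forall x : {x | U x},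
  exists (V : set 'rV[R]_k) (hVU : V `<=` U),
  [/\ open V, V (proj1_sig x) &
     (forall y, skel C N (prestr hVU Q y)) \/
     exists (j : cells C N) (p : {y | V y} -> 'rV[R]_N * 'rV[R]_(cdim j))
         (hD : forall y, @Disk R N (cdim j) (p y)),
         eplot p /\ forall y, prestr hVU Q y = proj1_sig (chr (exist _ (p y) (hD y)))].
Proof.
move=> dQ hQ x.
have compat j s (hs : @Sph R N (@cdim _ _ C N j) s) (hd : @Disk R N (cdim j) s) :
    chr (exist _ s hd) = incl (att (exist _ s hs)).
  by apply: exist_eq; rewrite (chr_att hs).
have [||//|u [su u1 u2 _]] := @pushout _ _ C N (DSpace (pushout_diffeology N)) (@incl N) (@chr _ _ C N).
- move=> k' V P hA dP; split; first exact: plot_open dP.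
  move=> y; exists V, (@subset_refl _ V); split; [exact: plot_open dP|exact: proj2_sig|].
  constructor 1; split=> [z|]; first exact: hA.
  by have := dplot_prestr (@subset_refl _ V) (plot_open dP) dP.
- move=> j k' V P hA eP; have oV := eP.1; split=> // y.
  exists V, (@subset_refl _ V); split=> //; first exact: proj2_sig.
  constructor 2; exists j, (prestr (@subset_refl _ V) P), (fun z => hA _); split; last by [].
  have [_ [s1 s2]] := eP; split; [exact: oV|split].
    exact: smooth_sub_prestr oV s1.
  exact: smooth_sub_prestr oV s2.
(* Uniqueness is applied in the indiscrete space, where smoothness of [u] and of the identity is
   automatic. *)
have uid y : u y = y.
  have [||//|w [_ _ _ Hw]] := @pushout _ _ C N (indiscrete R {x | skel C N.+1 x})
     (@incl N) (@chr _ _ C N).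
  - by move=> k' V P hA /plot_open.
  - by move=> j k' V P hA [].
  have -> : u y = w y by apply: Hw => // k' V P hA /plot_open.
  by symmetry; apply: (Hw id) => // k' V P hA /plot_open.
have [oU H] := su _ _ _ hQ dQ.
have [V [hVU [oV Vx {}H]]] := H x.
have E y : proj1_sig (prestr hVU (u \o lift_in hQ) y) = prestr hVU Q y.
  by rewrite /prestr /= uid.
exists V, hVU; split=> //; case: H => [[H1 _]|[j [p [hD [ep H]]]]|[z H]].
- by left => y; rewrite -E.
- by right; exists j, p, hD; split; [exact: ep|move=> y; rewrite -E H].
- have [Hz|[j [d Hd]]] := skelS_cover (proj2_sig z).
    by left => y; rewrite -E H.
  right; exists j, (fun=> proj1_sig d), (fun=> proj2_sig d); split.
    split; [exact: oV|split].
      by apply/(smooth_subP (f := fun=> (proj1_sig d).1) oV); [|exact: smooth_on_cst].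
    by apply/(smooth_subP (f := fun=> (proj1_sig d).2) oV); [|exact: smooth_on_cst].
  by move=> y; rewrite -E H Hd; case: (d).
Qed.

Definition smooth_on_skel N (f : X -> R) : Prop :=
  forall k (U : set 'rV[R]_k) (P : {x | U x} -> X), dplot P ->
    (forall x, skel C N (P x)) -> smooth_sub (f \o P).

(** The function is built as a map of sets, with the indiscrete reals as target; its smoothness is
    read off the local lifts of [skelS_lift]. *)
Lemma glue N (g : X -> R)
    (F : forall j : cells C N, 'rV[R]_N * 'rV[R]_(cdim j) -> R) :
  smooth_on_skel N g -> (forall j, pair_smooth (@Disk R N (cdim j)) (F j)) ->
  (forall j (s : {s | @Sph R N (cdim j) s}), F j (proj1_sig s) = g (proj1_sig (att s))) ->
  exists u : X -> R, [/\ smooth_on_skel N.+1 u,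
    (forall x, skel C N x -> u x = g x) &
    (forall j (d : {d | @Disk R N (cdim j) d}), u (proj1_sig (chr d)) = F j (proj1_sig d))].
Proof.
move=> sg sF gF.
have [|||u [_ u1 u2 _]] := @pushout _ _ C N (indiscrete R R)
   (fun x => g (proj1_sig x)) (fun j d => F j (proj1_sig d)).
- by move=> k U P hA /plot_open.
- by move=> j k U P hA [].
- by move=> j s hs hd /=; rewrite (gF j (exist _ s hs)).
pose v x := match pselect (skel C N.+1 x) with left h => u (exist _ x h) | right _ => 0 end.
have vE (x : {x | skel C N.+1 x}) : v (proj1_sig x) = u x.
  rewrite /v; case: pselect => [h|]; last by have := proj2_sig x.
  by congr u; exact: exist_eq.
have v1 x : skel C N x -> v x = g x.
  by move=> hx; have := vE (incl (exist _ x hx)); rewrite u1.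
have v2 j (d : {d | @Disk R N (@cdim _ _ C N j) d}) : v (proj1_sig (chr d)) = F j (proj1_sig d).
  by rewrite vE u2.
exists v; split=> // k U Q dQ hQ; apply: smooth_sub_local => x.
have [V [hVU [oV Vx H]]] := skelS_lift dQ hQ x.
exists V, hVU; split=> //; case: H => [H|[j [p [hD [ep H]]]]].
  have -> : prestr hVU (v \o Q) = g \o prestr hVU Q.
    by apply/funext => y; rewrite /= -v1.
  by apply: sg => //; exact: dplot_prestr.
have -> : prestr hVU (v \o Q) = F j \o p.
  by apply/funext => y; rewrite /= -[LHS]/(v (prestr hVU Q y)) H v2.
exact: pair_smooth_eplot (sF j) ep hD.
Qed.

Lemma smooth_att N j (g : X -> R) : smooth_on_skel N g ->
  exists2 G, pair_smooth setT G &
    forall s : {s | @Sph R N (@cdim _ _ C N j) s}, G (proj1_sig s) = g (proj1_sig (att s)).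
Proof.
move=> sg.
pose h s := match pselect (@Sph R N (@cdim _ _ C N j) s) with
  left hs => g (proj1_sig (att (exist _ s hs))) | right _ => 0 end.
have hE (s : {s | @Sph R N (@cdim _ _ C N j) s}) : h (proj1_sig s) = g (proj1_sig (att s)).
  rewrite /h; case: pselect => [hs|]; last by have := proj2_sig s.
  by congr (g (proj1_sig (att _))); exact: exist_eq.
have sh : pair_smooth (@Sph R N (@cdim _ _ C N j)) h.
  move=> k U P Q oU sP sQ PQ.
  have ep := eplot_pair oU sP sQ.
  have hA (x : {x | U x}) : @Sph R N (@cdim _ _ C N j) (P (proj1_sig x), Q (proj1_sig x)).
    by apply: PQ; exact: proj2_sig.
  have dp := @att_smooth _ _ C N j _ _ _ hA ep.
  have := sg _ _ _ dp (fun x => proj2_sig _).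
  move/smooth_subP; apply; first exact: oU.
  by move=> x /=; rewrite -hE.
have [G sG GE] := sphere_extension sh.
exists G => // s; rewrite GE//; exact: proj2_sig.
Qed.

Lemma smooth_skel_extension N (g : X -> R) : smooth_on_skel N g ->
  exists2 u, smooth_on_skel N.+1 u & forall x, skel C N x -> u x = g x.
Proof.
move=> sg.
pose G j := cid2 (@smooth_att N j g sg).
have [u [su u1 _]] := @glue N g (fun j => s2val (G j)) sg
  (fun j k U P Q oU sP sQ _ => s2valP (G j) k U P Q oU sP sQ (fun x _ => I))
  (fun j s => s2valP' (G j) s).
by exists u.
Qed.

End Skeleta.

(** * Size of the fat disks and compactness *)

Section DiskGeometry.
Variable R : realType.

Lemma integral0_ge0 (b : R) (f : R -> R) : (forall x, 0 <= f x) -> 0 <= Defs.integral0 b f.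
Proof. by move=> f0; apply: Rintegral_ge0 => x _; exact: f0. Qed.

Lemma phi_ge0 (t : R) : 0 <= phi t.
Proof.
have b0 (x : R) : 0 <= bumpf x by rewrite /bumpf mulr_ge0 ?ell_ge0.
apply: integral0_ge0 => x; rewrite /lam mulr_ge0// ?invr_ge0; exact: integral0_ge0.
Qed.

Lemma phi_eq0 (t : R) : t < - 2^-1 -> phi t = 0.
Proof.
move=> t0; rewrite /phi /Defs.integral0.
have -> : [set` `[0, 2^-1 + t]] = set0 :> set R.
  by rewrite set_itv_ge// bnd_simp -ltNge; lra.
exact: Rintegral_set0.
Qed.

Lemma Sph_Disk n m (s : 'rV[R]_n * 'rV[R]_m) : @Sph R n m s -> @Disk R n m s.
Proof.
rewrite /Sph /Disk /= => s1; apply: le_trans s1.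
by rewrite gerBl phi_ge0.
Qed.

Lemma enorm_sqr n (u : 'rV[R]_n) : enorm u ^+ 2 = sqn u.
Proof. by rewrite sqr_sqrtr// sqn_ge0. Qed.

(** Off the sphere region |u| < 1, so [phi] cannot vanish and its argument is at least -1/2; then
    |v| <= 5/2, and 1 + 25/4 <= 8. The bound does not depend on the cell. *)
Lemma Disk_bounded n m (d : 'rV[R]_n * 'rV[R]_m) : @Disk R n m d ->
  ~ @Sph R n m d -> sqn d.1 + sqn d.2 <= 8.
Proof.
rewrite /Disk /Sph /= => dD /negP; rewrite -ltNge => d1.
have u0 : 0 <= enorm d.1 by exact: sqrtr_ge0.
have v0 : 0 <= enorm d.2 by exact: sqrtr_ge0.
have [t|t] := ltP (2 - enorm d.1 - enorm d.2) (- 2^-1).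
  by move: dD; rewrite phi_eq0//; lra.
rewrite -!enorm_sqr; have v1 : enorm d.2 <= 5 / 2 by lra.
by nra.
Qed.

Lemma ell_bound1 (t : R) : 1 <= t -> expR (-1) <= ell t.
Proof.
move=> t1; have t0 : 0 < t by lra.
by rewrite /ell ifF ?ler_expR ?lerN2 ?invf_le1//; apply/negbTE; rewrite -ltNge.
Qed.

Lemma pair_smooth_weaken n m (A B : set ('rV[R]_n * 'rV[R]_m)) g : A `<=` B ->
  pair_smooth B g -> pair_smooth A g.
Proof.
by move=> AB sg k U P Q oU sP sQ PQ; apply: (sg _ _ _ _ oU sP sQ) => x /PQ /AB.
Qed.

Lemma pair_smooth_continuous n m (g : 'rV[R]_n * 'rV[R]_m -> R) :
  pair_smooth setT g -> continuous g.
Proof.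
move=> sg [u v].
have s := sg _ setT (fun x : 'rV[R]_(n + m) => lsubmx x) (fun x => rsubmx x) openT
  (smooth_on_lsubmx openT) (smooth_on_rsubmx openT) (fun x _ => I).
have cr : {for (u, v), continuous (fun p : 'rV[R]_n * 'rV[R]_m => row_mx p.1 p.2)}.
  apply: mx_continuousP => i j; rewrite ord1 {i}.
  case: (splitP j) => l jl.
    have -> : (fun y : 'rV[R]_n * 'rV[R]_m => row_mx y.1 y.2 ord0 j) = (fun y => y.1 ord0 l).
      by apply/funext => y; rewrite (_ : j = lshift m l) ?row_mxEl//; exact/val_inj.
    apply: (@continuous_comp _ _ _ fst (fun y : 'rV[R]_n => y ord0 l)).
      exact: cvg_fst.
    exact: coord_continuous.
  have -> : (fun y : 'rV[R]_n * 'rV[R]_m => row_mx y.1 y.2 ord0 j) = (fun y => y.2 ord0 l).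
    by apply/funext => y; rewrite (_ : j = rshift n l) ?row_mxEr//; exact/val_inj.
  apply: (@continuous_comp _ _ _ snd (fun y : 'rV[R]_m => y ord0 l)).
    exact: cvg_snd.
  exact: coord_continuous.
have := continuous_comp cr (smooth_on_continuous s I).
have -> // : (fun x : 'rV[R]_(n + m) => g (lsubmx x, rsubmx x)) \o
  (fun p : 'rV[R]_n * 'rV[R]_m => row_mx p.1 p.2) = g.
by apply/funext => -[a b] /=; rewrite row_mxKl row_mxKr.
Qed.

Lemma pair_smooth_sqn n m : pair_smooth setT
  (fun p : 'rV[R]_n * 'rV[R]_m => sqn p.1 + sqn p.2).
Proof.
move=> k U P Q oU sP sQ _.
by apply: smooth_onD; [exact: oU|exact: smooth_on_sqn|exact: smooth_on_sqn].
Qed.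

Lemma pair_smooth_ell n m (M : R) : pair_smooth setT
  (fun p : 'rV[R]_n * 'rV[R]_m => ell (M - (sqn p.1 + sqn p.2))).
Proof.
move=> k U P Q oU sP sQ H; apply: smooth_on_ell; first exact: oU.
apply: smooth_onB; [exact: oU|exact: smooth_on_cst|].
exact: (pair_smooth_sqn oU sP sQ H).
Qed.

Lemma pair_smoothM n m A (f g : 'rV[R]_n * 'rV[R]_m -> R) :
  pair_smooth A f -> pair_smooth A g -> pair_smooth A (fun p => f p * g p).
Proof.
move=> sf sg k U P Q oU sP sQ H.
by apply: smooth_onM; [exact: oU|exact: sf oU sP sQ H|exact: sg oU sP sQ H].
Qed.

Lemma sqr_coord_le_sqn n (u : 'rV[R]_n) i : u ord0 i ^+ 2 <= sqn u.
Proof.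
by rewrite /sqn (bigD1 i)//= lerDl sumr_ge0// => j _; exact: sqr_ge0.
Qed.

Lemma compact_sqn n m (M : R) :
  compact [set p : 'rV[R]_n * 'rV[R]_m | sqn p.1 + sqn p.2 <= M].
Proof.
have coordM l (u : 'rV[R]_l) : sqn u <= M -> `|u| <= M + 1.
  move=> uM; have M0 : 0 <= M by exact: le_trans (sqn_ge0 _) uM.
  rewrite /Num.Def.normr/= mx_normrE bigmax_le//= ?addr_ge0// => -[i j] _ /=.
  rewrite ord1 ler_norml.
  have := le_trans (sqr_coord_le_sqn u j) uM.
  by move: (u ord0 j) => t tM; apply/andP; split; nra.
have cb l : compact [set u : 'rV[R]_l | `|u| <= M + 1].
  apply: bounded_closed_compact.
    exists (M + 1); split; first exact: num_real.
    by move=> t tM y /= /le_trans; apply; exact: ltW.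
  apply: (closed_comp (D := [set t : R | t <= M + 1])) => [y _|]; last exact: closed_le.
  exact: norm_continuous.
apply: (subclosed_compact _ (compact_setX (cb n) (cb m))).
  apply: (closed_comp (f := fun p : 'rV[R]_n * 'rV[R]_m => sqn p.1 + sqn p.2)
    (D := [set t : R | t <= M])) => [y _|]; last exact: closed_le.
  exact: (pair_smooth_continuous (@pair_smooth_sqn n m)).
by move=> [u v] /= uv; split; apply: coordM => /=;
  have := sqn_ge0 u; have := sqn_ge0 v; lra.
Qed.

End DiskGeometry.

(** * Chart functions and separation of points *)

Section Regular.
Variables (R : realType) (X : dspace R) (C : fatCW X).
Hypothesis regC : regularCW C.

(** The substitute for a Hausdorff D-topology on the skeleton. *)
Definition separated N := forall p q, skel C N p -> skel C N q ->
  (forall f, smooth_on_skel C N f -> f p = f q) -> p = q.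

Section Chart.
Variables (N : nat) (j : cells C N)
  (B : forall j : cells C N, 'rV[R]_N * 'rV[R]_(cdim j) -> R).

Lemma att_inj (j1 j2 : cells C N) (s : {s | @Sph R N (cdim j1) s})
    (s' : {s | @Sph R N (cdim j2) s}) :
  proj1_sig (att s) = proj1_sig (att s') ->
  existT (fun j => {s | @Sph R N (cdim j) s}) j1 s = existT _ j2 s'.
Proof. by have [H _ _] := regC N; exact: H. Qed.

(** Injectivity of the attaching maps makes the chosen preimage irrelevant. [B] is a family over all
    cells so that an equality of indices needs no transport. *)
Definition push_att (x : X) : R :=
  match pselect (exists s : {s | @Sph R N (cdim j) s}, x = proj1_sig (att s)) with
  | left h => B (proj1_sig (proj1_sig (cid h))) | right _ => 0 end.

Lemma push_attE (s : {s | @Sph R N (cdim j) s}) :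
  push_att (proj1_sig (att s)) = B (proj1_sig s).
Proof.
rewrite /push_att; case: pselect => [h|]; last by case; exists s.
case: cid => s' e /=; have H := att_inj e.
by have := congr1 (fun t : {j & {s | @Sph R N (cdim j) s}} =>
  B (proj1_sig (projT2 t))) H.
Qed.

Lemma push_att_eq0 x :
  (forall s : {s | @Sph R N (cdim j) s}, x <> proj1_sig (att s)) -> push_att x = 0.
Proof.
move=> xs; rewrite /push_att; case: pselect => // h.
by exfalso; case: h => s /xs.
Qed.

Lemma push_att_other (j' : cells C N) (s : {s | @Sph R N (cdim j') s}) :
  j' <> j -> push_att (proj1_sig (att s)) = 0.
Proof.
move=> jj; apply: push_att_eq0 => s' e; apply: jj.
exact: (congr1 (@projT1 _ _) (att_inj e)).
Qed.

Variable M : R.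
Hypothesis sB : forall j', pair_smooth setT (@B j').
Hypothesis BM : forall p : 'rV[R]_N * 'rV[R]_(cdim j),
  M < sqn p.1 + sqn p.2 -> B p = 0.

(* The image of a closed ball of the sphere region is compact, hence closed in
   the skeleton because smooth functions separate points. *)
Lemma push_att_near0 k (U : set 'rV[R]_k) (Q : {x | U x} -> X) : separated N ->
  dplot Q -> (forall x, skel C N (Q x)) -> forall x : {x | U x},
  (forall s : {s | @Sph R N (cdim j) s}, Q x <> proj1_sig (att s)) ->
  \forall y \near proj1_sig x, forall h : U y, push_att (Q (exist _ y h)) = 0.
Proof.
move=> sepN dQ hQ x Qx.
have oU := plot_open dQ.
pose P (y : 'rV[R]_k) (s : 'rV[R]_N * 'rV[R]_(cdim j)) :=
  forall (h : U y) (hs : @Sph R N (cdim j) s),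
    Q (exist _ y h) <> proj1_sig (att (exist _ s hs)).
have := (compact_near_coveringP _).1 (@compact_sqn R N (cdim j) M)
  _ (nbhs (proj1_sig x)) P (nbhs_filter _).
have cover s : sqn s.1 + sqn s.2 <= M ->
    \forall s' \near s & y \near proj1_sig x, P y s'.
  move=> _; have [hs|nhs] := pselect (@Sph R N (cdim j) s).
    (* Separation provides [f] with distinct values at [Q x] and at the attached point. Nearby,
       [f \o Q] and the extension [G] of [f] along the attaching map stay within half the gap, so
       the points cannot coincide. *)
    have [f [sf fne]] : exists f, smooth_on_skel C N f /\
        f (Q x) <> f (proj1_sig (att (exist _ s hs))).
      apply: contrapT => nf; apply: (Qx (exist _ s hs)).
      apply: sepN; [exact: hQ|exact: proj2_sig|].
      by move=> f sf; apply: contrapT => fne; apply: nf; exists f.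
    have [G sG GE] := smooth_att j sf.
    have cG : {for s, continuous G} by exact: pair_smooth_continuous.
    have cf : {for proj1_sig x, continuous (extend0 (f \o Q))}.
      exact: (smooth_on_continuous (sf _ _ _ dQ hQ) (proj2_sig x)).
    pose a := G s; pose b := extend0 (f \o Q) (proj1_sig x).
    have ab : a != b.
      apply/eqP => e; apply: fne; rewrite -(GE (exist _ s hs)) /= -[G s]/a e /b.
      by rewrite extend0E.
    pose e := `|a - b| / 2.
    have e0 : 0 < e by rewrite divr_gt0// normr_gt0 subr_eq0.
    have /cvgrPdist_lt /(_ _ e0) nG := cG.
    have nf := (@cvgrPdist_lt _ _ _ _ (nbhs_filter (proj1_sig x)) _ _).1 cf e e0.
    exists ([set s' | `|a - G s'| < e], [set y | `|b - extend0 (f \o Q) y| < e]).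
      by split.
    case=> s' y [/= s'e ye] h hs' QE.
    have : G s' = extend0 (f \o Q) y.
      rewrite (GE (exist _ s' hs')) -QE.
      by have := extend0E (f \o Q) (exist _ y h).
    move=> E; move: s'e ye; rewrite E /e; move: (extend0 _ _) => c.
    have := ler_distD c a b; rewrite (distrC c b).
    by lra.
  have ns : \forall s' \near s, ~ @Sph R N (cdim j) s'.
    have s1 : sqn s.1 < 1 by rewrite ltNge; apply/negP => /Sph_sqn.
    have sq : pair_smooth setT (fun p : 'rV[R]_N * 'rV[R]_(cdim j) => sqn p.1).
      by move=> k' U' P' Q' oU' sP' sQ' _; exact: smooth_on_sqn.
    have c : {for s, continuous (fun p : 'rV[R]_N * 'rV[R]_(cdim j) => sqn p.1)}.
      exact: pair_smooth_continuous.
    have o : nbhs (sqn s.1) [set t : R | t < 1].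
      by apply: open_nbhs_nbhs; split; [exact: open_lt|].
    have n : nbhs s [set s' : 'rV[R]_N * 'rV[R]_(cdim j) | sqn s'.1 < 1] := c _ o.
    by apply: filterS n => s' /= s'1 /Sph_sqn; rewrite leNgt s'1.
  exists ([set s' | ~ @Sph R N (cdim j) s'], setT); first by split=> //; exact: filterT.
  by case=> s' y [/= ns' _] h hs.
move=> /(_ cover); apply: filterS => y KP h.
apply: contrapT => nz.
have [[s QE]|nQ] := pselect (exists s : {s | @Sph R N (cdim j) s},
    Q (exist _ y h) = proj1_sig (att s)); last first.
  by apply: nz; apply: push_att_eq0 => s QE; apply: nQ; exists s.
have [sM|sM] := leP (sqn (proj1_sig s).1 + sqn (proj1_sig s).2) M.
  have := KP (proj1_sig s) sM h (proj2_sig s); apply.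
  by rewrite QE; congr (proj1_sig (att _)); exact: exist_eq.
by apply: nz; rewrite QE push_attE BM.
Qed.

(** Near a point sent into the image of some attaching map, D-openness keeps the plot in the union
    of the images and the induction property lifts it to one sphere, where the function is [B] or 0.
    Elsewhere [push_att_near0] applies. *)
Lemma push_att_smooth : separated N -> smooth_on_skel C N push_att.
Proof.
move=> sepN k U Q dQ hQ.
have oU := plot_open dQ.
have [_ ind [_ Dopen]] := regC N.
apply: smooth_sub_local => x.
have [[j1 [s1 QE]]|nQ] := pselect (exists (j : cells C N) (s : {s | @Sph R N (cdim j) s}),
    Q x = proj1_sig (att s)).
  pose W := [set y : 'rV[R]_k | exists h : U y, exists (j : cells C N)
    (s : {s | @Sph R N (cdim j) s}), Q (exist _ y h) = proj1_sig (att s)].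
  have oW : open W := Dopen _ _ _ dQ hQ.
  have WU : W `<=` U by move=> y [].
  have Wx : W (proj1_sig x).
    exists (proj2_sig x), j1, s1; rewrite -QE; congr (Q _); exact: exist_eq.
  have dQ' := dplot_prestr WU oW dQ.
  have hW (y : {y | W y}) : exists (j : cells C N) (s : {s | @Sph R N (cdim j) s}),
      prestr WU Q y = proj1_sig (att s).
    have [h [j' [s H]]] := proj2_sig y; exists j', s; rewrite -H.
    by rewrite /prestr; congr Q; exact: exist_eq.
  have [V [hVW [j' [P [hS [oV Vx eP H]]]]]] := ind _ _ _ dQ' hW (exist _ _ Wx).
  have VU : V `<=` U := fun y Vy => WU y (hVW y Vy).
  exists V, VU; split=> //.
  have E y : prestr VU (push_att \o Q) y = push_att (proj1_sig (att (exist _ (P y) (hS y)))).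
    by rewrite H /prestr /=; congr (push_att (Q _)); exact: exist_eq.
  have [jj|jj] := pselect (j' = j).
    subst j'; have -> : prestr VU (push_att \o Q) = @B j \o P.
      by apply/funext => y; rewrite E push_attE.
    exact: pair_smooth_eplot (@sB j) eP (fun _ => I).
  have -> : prestr VU (push_att \o Q) = fun=> 0.
    by apply/funext => y; rewrite E push_att_other.
  by apply/(smooth_subP (f := fun=> 0) oV); [|exact: smooth_on_cst].
have Qx (s : {s | @Sph R N (cdim j) s}) : Q x <> proj1_sig (att s).
  by move=> QE; apply: nQ; exists j, s.
have n0 : nbhs (proj1_sig x) [set y | forall h : U y, push_att (Q (exist _ y h)) = 0].
  exact: push_att_near0.
move: n0; rewrite nbhsE => -[V' [oV' V'x] V'0].
pose V := U `&` V'.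
have VU : V `<=` U by move=> y [].
have oV : open V by exact: openI.
exists V, VU; split; [exact: oV|by split; [exact: proj2_sig|]|].
apply/(smooth_subP (f := fun=> 0) oV); last exact: smooth_on_cst.
by move=> y; rewrite /prestr /= V'0//; have [] := proj2_sig y.
Qed.

(** [B] on the cell [j] and 0 on the other cells are compatible with [push_att], because distinct
    cells have disjoint attached spheres. *)
Lemma chart_function : separated N ->
  exists u, [/\ smooth_on_skel C N.+1 u,
    (forall d : {d | @Disk R N (cdim j) d}, u (proj1_sig (chr d)) = B (proj1_sig d)) &
    (forall x, skel C N.+1 x ->
       (forall d : {d | @Disk R N (cdim j) d}, x <> proj1_sig (chr d)) -> u x = 0)].
Proof.
move=> sepN.
pose F (j' : cells C N) (p : 'rV[R]_N * 'rV[R]_(cdim j')) : R :=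
  if pselect (j' = j) then B p else 0.
have [||u [su u1 u2]] := @glue _ _ C N push_att F (push_att_smooth sepN).
- move=> j'; apply: (@pair_smooth_weaken _ _ _ _ setT) => // k U P Q oU sP sQ H.
  rewrite /F; case: (pselect (j' = j)) => [h|h] /=; first exact: (sB oU sP sQ H).
  exact: smooth_on_cst.
- move=> j' s; rewrite /F; have [jj|jj] := pselect (j' = j).
    by subst j'; rewrite push_attE; case: pselect.
  by rewrite push_att_other//; case: pselect.
exists u; split=> // [d|x hx nx].
  by rewrite u2 /F; case: pselect.
have [hN|[j' [d xd]]] := skelS_cover hx.
  rewrite u1// push_att_eq0// => s xs.
  apply: (nx (exist _ _ (Sph_Disk (proj2_sig s)))).
  rewrite xs (chr_att (proj2_sig s)); congr (proj1_sig (att _)); exact: exist_eq.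
rewrite xd u2 /F; case: pselect => // jj; subst j'.
by have := nx d xd.
Qed.

End Chart.

(** Wherever the bump [u0] is positive, the quotients of [u1] and [u2] by [u0] recover the
    coordinates of the cell; [M] sets the size of this region. *)
Lemma chart_coordinates N (j : cells C N) (M : R) : separated N ->
  exists u0 (u1 : 'I_N -> X -> R) (u2 : 'I_(cdim j) -> X -> R),
  [/\ smooth_on_skel C N.+1 u0,
      (forall i, smooth_on_skel C N.+1 (u1 i)) /\
      (forall i, smooth_on_skel C N.+1 (u2 i)),
      (forall x, skel C N.+1 x -> 0 < u0 x ->
         exists d : {d | @Disk R N (cdim j) d}, x = proj1_sig (chr d)) &
      forall d : {d | @Disk R N (cdim j) d},
        let p := proj1_sig d in let x := proj1_sig (chr d) in
        [/\ u0 x = ell (M - (sqn p.1 + sqn p.2)),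
            forall i, u1 i x = p.1 ord0 i * u0 x &
            forall i, u2 i x = p.2 ord0 i * u0 x]].
Proof.
move=> sepN.
pose b j' (p : 'rV[R]_N * 'rV[R]_(@cdim _ _ C N j')) := ell (M - (sqn p.1 + sqn p.2)).
have bM (p : 'rV[R]_N * 'rV[R]_(cdim j)) : M < sqn p.1 + sqn p.2 -> b j p = 0.
  by move=> Mp; apply: ell_le0; rewrite subr_le0 ltW.
have sb j' : pair_smooth setT (b j') by exact: pair_smooth_ell.
have [u0 [s0 c0 z0]] := chart_function sb bM sepN.
have H1 i : exists u, smooth_on_skel C N.+1 u /\
    forall d : {d | @Disk R N (cdim j) d},
      u (proj1_sig (chr d)) = (proj1_sig d).1 ord0 i * u0 (proj1_sig (chr d)).
  have [|||u [su cu _]] := @chart_function N j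
      (fun j' p => p.1 ord0 i * b j' p) M.
  - move=> j'; apply: pair_smoothM; last exact: sb.
    by move=> k U P Q oU sP sQ _; exact: rV_smooth_on.
  - by move=> p /bM ->; rewrite mulr0.
  - exact: sepN.
  by exists u; split=> // d; rewrite cu c0.
have H2 (i : 'I_(cdim j)) : exists u, smooth_on_skel C N.+1 u /\
    forall d : {d | @Disk R N (cdim j) d},
      u (proj1_sig (chr d)) = (proj1_sig d).2 ord0 i * u0 (proj1_sig (chr d)).
  (* The index [i] belongs to the cell [j], but a function on every cell is required; the sum
     selects the coordinate with the same number, if there is one. *)
  pose v j' (p : 'rV[R]_N * 'rV[R]_(@cdim _ _ C N j')) : R :=
    \sum_(l < cdim j' | (l == i :> nat)) p.2 ord0 l.
  have [|||u [su cu _]] := @chart_function N j (fun j' p => v j' p * b j' p) M.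
  - move=> j'; apply: pair_smoothM; last exact: sb.
    move=> k U P Q oU sP sQ _; rewrite /v /=.
    apply: (@eq_smooth_on _ _ _ _ (fun x => \sum_(l < cdim j') ((l == i :> nat)%:R * Q x ord0 l))).
    + exact: oU.
    + move=> x _; rewrite [RHS]big_mkcond /=; apply: eq_bigr => l _.
      by case: ifP => _; rewrite ?mul1r ?mul0r.
    apply: smooth_on_sum; first exact: oU.
    move=> l; apply: smooth_onM; [exact: oU|exact: smooth_on_cst|].
    exact: (rV_smooth_on l oU sQ).
  - by move=> p /bM ->; rewrite mulr0.
  - exact: sepN.
  exists u; split=> // d; rewrite cu c0; congr (_ * _); rewrite /v.
  rewrite (big_pred1 i)// => l; apply/eqP/eqP => [e|-> //]; exact/val_inj.
pose U1 i := cid (H1 i). pose U2 i := cid (H2 i).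
exists u0, (fun i => proj1_sig (U1 i)), (fun i => proj1_sig (U2 i)).
split; first exact: s0.
- by split=> i; [have [] := proj2_sig (U1 i)|have [] := proj2_sig (U2 i)].
- move=> x hx x0; apply: contrapT => nd.
  by move: x0; rewrite z0 ?ltxx// => d xd; apply: nd; exists d.
- move=> d /=; split; first exact: c0.
    by move=> i; have [_ ->] := proj2_sig (U1 i).
  by move=> i; have [_ ->] := proj2_sig (U2 i).
Qed.

(** If one point lies in a cell image, a bump positive there is positive at the other point too,
    which then lies in the same cell image with the same coordinates. Two points of the lower
    skeleton are separated by extended functions. *)
Lemma separatedS N : separated N -> separated N.+1.
Proof.
move=> sepN.
have chart (j : cells C N) (d : {d | @Disk R N (cdim j) d}) q : skel C N.+1 q ->
    (forall f, smooth_on_skel C N.+1 f -> f (proj1_sig (chr d)) = f q) ->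
    proj1_sig (chr d) = q.
  move=> hq H.
  (* With this [M] the bump takes the value [ell 1] at the given point. *)
  pose M := 1 + (sqn (proj1_sig d).1 + sqn (proj1_sig d).2).
  have [u0 [u1 [u2 [s0 [s1 s2] r0 c]]]] := chart_coordinates j M sepN.
  have [d0 d1 d2] := c d.
  have p0 : 0 < u0 (proj1_sig (chr d)) by rewrite d0 ell_gt0// /M addrK.
  have q0 : 0 < u0 q by rewrite -(H _ s0).
  have [d' qd] := r0 q hq q0.
  have [d0' d1' d2'] := c d'; rewrite -qd in d0' d1' d2'.
  have n0 : u0 q != 0 by rewrite gt_eqF.
  rewrite qd; congr (proj1_sig (chr _)); apply: exist_eq.
  rewrite [LHS]surjective_pairing [RHS]surjective_pairing; congr (_, _).
    apply/rowP => i; apply: (mulIf n0).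
    by rewrite -d1' -(H _ (s1 i)) d1 (H _ s0).
  apply/rowP => i; apply: (mulIf n0).
  by rewrite -d2' -(H _ (s2 i)) d2 (H _ s0).
move=> p q hp hq H.
have [hpN|[j [d pd]]] := skelS_cover hp; last first.
  by rewrite pd; apply: chart => // f sf; rewrite -pd H.
have [hqN|[j [d qd]]] := skelS_cover hq; last first.
  by symmetry; rewrite qd; apply: chart => // f sf; rewrite -qd H.
apply: sepN => // f sf; have [g sg gE] := smooth_skel_extension sf.
by rewrite -gE// -[RHS]gE// H.
Qed.

Lemma separated_skel N : separated N.
Proof.
elim: N => [p q|N IH]; last exact: separatedS.
by rewrite skel0.
Qed.

End Regular.

(** * Preplots are plots, by induction on the skeleta *)

Section Reflexivity.
Variables (R : realType) (X : dspace R) (C : fatCW X).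
Hypothesis regC : regularCW C.

Definition skel_preplot N k (U : set 'rV[R]_k) (P : {x | U x} -> X) : Prop :=
  [/\ open U, (forall x, skel C N (P x)) &
      forall f, smooth_on_skel C N f -> smooth_sub (f \o P)].

Lemma skel_preplot_chart N k (U : set 'rV[R]_k) (P : {x | U x} -> X)
    (j : cells C N) (d : {d | @Disk R N (cdim j) d}) (x : {x | U x}) :
  skel_preplot N.+1 P -> P x = proj1_sig (chr d) ->
  exists (V : set 'rV[R]_k) (hVU : V `<=` U),
    [/\ open V, V (proj1_sig x) & dplot (prestr hVU P)].
Proof.
move=> [oU hP sP] Px.
pose M := 1 + (sqn (proj1_sig d).1 + sqn (proj1_sig d).2).
have [u0 [u1 [u2 [s0 [s1 s2] r0 c]]]] := chart_coordinates regC j M (@separated_skel _ _ _ regC N).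
pose e (f : X -> R) := extend0 (f \o P).
have eE f y : e f (proj1_sig y) = f (P y) by exact: (extend0E (f \o P)).
pose V := U `&` [set y | 0 < e u0 y].
have VU : V `<=` U by move=> y [].
have oV : open V := open_preimage oU (@open_gt R 0) (sP _ s0).
have [d0 _ _] := c d.
have Vx : V (proj1_sig x).
  by split; [exact: proj2_sig|rewrite /= eE Px d0 ell_gt0// /M addrK].
pose p1 y : 'rV[R]_N := \row_i (e (u1 i) y * (e u0 y)^-1).
pose p2 y : 'rV[R]_(cdim j) := \row_i (e (u2 i) y * (e u0 y)^-1).
have sV f : smooth_on_skel C N.+1 f -> smooth_on V (e f).
  by move=> /sP sf; exact: smooth_on_sub VU sf.
have si : smooth_on V (fun y => (e u0 y)^-1).
  by apply: smooth_onV; [exact: oV|move=> y [_ /= y0]; rewrite gt_eqF|exact: sV].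
have sp1 : smooth_on V p1.
  apply: smooth_on_rV => [|i]; first exact: oV.
  have -> : (fun y => p1 y ord0 i) = (fun y => e (u1 i) y * (e u0 y)^-1).
    by apply/funext => y; rewrite mxE.
  by apply: smooth_onM; [exact: oV|exact: (sV _ (s1 i))|exact: si].
have sp2 : smooth_on V p2.
  apply: smooth_on_rV => [|i]; first exact: oV.
  have -> : (fun y => p2 y ord0 i) = (fun y => e (u2 i) y * (e u0 y)^-1).
    by apply/funext => y; rewrite mxE.
  by apply: smooth_onM; [exact: oV|exact: (sV _ (s2 i))|exact: si].
have H (y : {y | V y}) : exists d' : {d | @Disk R N (cdim j) d},
    prestr VU P y = proj1_sig (chr d') /\ (p1 (proj1_sig y), p2 (proj1_sig y)) = proj1_sig d'.
  pose z : {x | U x} := exist _ (proj1_sig y) (VU _ (proj2_sig y)).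
  have z0 : 0 < u0 (P z) by rewrite -eE; have [] := proj2_sig y.
  have [d' Pd'] := r0 _ (hP z) z0.
  exists d'; split; first exact: Pd'.
  have [_ d1 d2] := c d'; rewrite -Pd' in d1 d2.
  have n0 : u0 (P z) != 0 by rewrite gt_eqF.
  rewrite [RHS]surjective_pairing; congr (_, _); apply/rowP => i; rewrite mxE.
    by rewrite (eE _ z) (eE _ z) d1 mulfK.
  by rewrite (eE _ z) (eE _ z) d2 mulfK.
have hA (y : {y | V y}) : @Disk R N (cdim j) (p1 (proj1_sig y), p2 (proj1_sig y)).
  by have [d' [_ ->]] := H y; exact: proj2_sig.
exists V, VU; split; [exact: oV|exact: Vx|].
have := @chr_smooth _ _ C N j _ _ _ hA (eplot_pair oV sp1 sp2).
congr dplot; apply/funext => y /=.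
have [d' [-> d'E]] := H y; congr (proj1_sig (chr _)); exact: exist_eq.
Qed.

(* Near a point sent to the lower skeleton away from the charts, a preplot stays
   in the lower skeleton: each cell is avoided on some ball by a bump function,
   and a single function, normalized on one nearly closest point of each cell,
   makes the ball independent of the cell. *)
Lemma skel_preplot_lower N k (U : set 'rV[R]_k) (P : {x | U x} -> X) (x : {x | U x}) :
  skel_preplot N.+1 P ->
  (forall (j : cells C N) (d : {d | @Disk R N (cdim j) d}), P x <> proj1_sig (chr d)) ->
  exists (V : set 'rV[R]_k) (hVU : V `<=` U),
    [/\ open V, V (proj1_sig x) & forall y, skel C N (prestr hVU P y)].
Proof.
move=> [oU hP sP] nchr.
set x0 := proj1_sig x.
have hPx : skel C N (P x).
  by have [//|[j [d Pd]]] := skelS_cover (hP x); have := nchr j d Pd.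
pose open_cell (j : cells C N) (y : X) := exists d : {d | @Disk R N (cdim j) d},
  ~ @Sph R N (cdim j) (proj1_sig d) /\ y = proj1_sig (chr d).
pose A j := [set y : 'rV[R]_k | exists h : U y, open_cell j (P (exist _ y h))].
have near_lt (f : X -> R) (b : R) : smooth_on_skel C N.+1 f -> f (P x) < b ->
    \forall y \near x0, forall h : U y, f (P (exist _ y h)) < b.
  move=> sf fb.
  have cf : {for x0, continuous (extend0 (f \o P))}.
    exact: (smooth_on_continuous (sP f sf) (proj2_sig x)).
  have o : nbhs (extend0 (f \o P) x0) [set t : R | t < b].
    apply: open_nbhs_nbhs; split; first exact: open_lt.
    by rewrite /= (extend0E (f \o P)).
  have n : nbhs x0 [set y | extend0 (f \o P) y < b] := cf _ o.
  apply: filterS n => y /= yb h.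
  by have := extend0E (f \o P) (exist _ y h) => /= <-.
have far j : exists2 r : R, 0 < r & forall y, A j y -> r <= `|x0 - y|.
  (* By [Disk_bounded] the squared norm is at most 8 on the open cell, so with 9 the bump is at
     least exp(-1) on all of it, while it is at most 0 at [P x]. *)
  have [u0 [u1 [u2 [s0 _ r0 c]]]] := chart_coordinates regC j 9 (@separated_skel _ _ _ regC N).
  have u0x : u0 (P x) <= 0.
    by rewrite leNgt; apply/negP => /(r0 _ (hP x)) [d]; exact: nchr.
  have /nbhs_ballP [r /= r_gt0 rP] := near_lt u0 (expR (-1)) s0 (le_lt_trans u0x (expR_gt0 _)).
  exists r => // y [h [d [nS Pd]]]; rewrite leNgt; apply/negP => yr.
  have yb : ball x0 r y by rewrite -ball_normE.
  have := rP y yb h; rewrite Pd; have [-> _ _] := c d.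
  rewrite ltNge => /negP; apply; apply: ell_bound1.
  have := Disk_bounded (proj2_sig d) nS; lra.
(* By [far] the infimum of the distances is positive, so some attained distance is below twice the
   infimum. *)
have pick j : exists y, (exists y', A j y') ->
    A j y /\ forall y', A j y' -> `|x0 - y| <= 2 * `|x0 - y'|.
  have [[y' Ay']|nA] := pselect (exists y', A j y'); last by exists x0.
  have [r r_gt0 rA] := far j.
  pose S := [set `|x0 - y| | y in A j].
  have Sinf : has_inf S.
    by split; [exists `|x0 - y'|, y'|exists r => _ [y Ay <-]; exact: rA].
  have Sr : r <= inf S by apply: lb_le_inf; [exact: Sinf.1|move=> _ [y Ay <-]; exact: rA].
  have I0 : 0 < inf S by exact: lt_le_trans Sr.
  have [_ [y Ay <-] yS] := inf_adherent I0 Sinf.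
  exists y => _; split=> // y'' Ay''.
  have : inf S <= `|x0 - y''| by apply: ge_inf; [exact: Sinf.2|exists y''].
  by lra.
pose xj j := proj1_sig (cid (pick j)).
have xjP j : (exists y', A j y') ->
    A j (xj j) /\ forall y', A j y' -> `|x0 - xj j| <= 2 * `|x0 - y'|.
  exact: (proj2_sig (cid (pick j))).
(* Normalizes the function of the cell to 1 at the chosen point. The constants may be unbounded over
   the cells, as gluing imposes no condition between cells. *)
have coef j : exists c : R, (exists y', A j y') -> forall h : U (xj j),
    exists2 d : {d | @Disk R N (cdim j) d}, P (exist _ (xj j) h) = proj1_sig (chr d) &
      c * ell (1 - sqn (proj1_sig d).1) = 1.
  have [/xjP [[h [d [nS Pd]]] _]|nA] := pselect (exists y', A j y'); last by exists 0.
  exists (ell (1 - sqn (proj1_sig d).1))^-1 => _ h'; exists d.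
    by rewrite -Pd; congr P; exact: exist_eq.
  have d1 : sqn (proj1_sig d).1 < 1 by rewrite ltNge; apply/negP => /Sph_sqn.
  by rewrite mulVf// gt_eqF// ell_gt0// subr_gt0.
pose cj j := proj1_sig (cid (coef j)).
(* [ell (1 - sqn p.1)] vanishes exactly on the sphere region, so it glues with 0. *)
have [|||u [su u0 uc]] := @glue _ _ C N (fun=> 0)
   (fun j p => cj j * ell (1 - sqn p.1)).
- move=> k' U' P' dP' _; have oU' := plot_open dP'.
  by apply/(smooth_subP (f := fun=> 0) oU'); [|exact: smooth_on_cst].
- move=> j k' U' P' Q' oU' sP' sQ' _.
  apply: smooth_onM; [exact: oU'|exact: smooth_on_cst|].
  apply: smooth_on_ell; first exact: oU'.
  by apply: smooth_onB; [exact: oU'|exact: smooth_on_cst|exact: smooth_on_sqn].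
- move=> j [s hs] /=; rewrite ell_le0 ?mulr0// subr_le0; exact/Sph_sqn.
have ux : u (P x) < 1 by rewrite u0// ltr01.
have /nbhs_ballP [r /= r_gt0 rP] := near_lt u 1 su ux.
have xj_far j : (exists y', A j y') -> r <= `|x0 - xj j|.
  move=> Aj; rewrite leNgt; apply/negP => xr.
  have xb : ball x0 r (xj j) by rewrite -ball_normE.
  have [[h _] _] := xjP j Aj.
  have [d Pd cd] := proj2_sig (cid (coef j)) Aj h.
  by have := rP _ xb h; rewrite Pd uc cd ltxx.
(* A point of [V] in [A j] would put the chosen point of that cell at distance less than [r], where
   [u] is below 1. *)
pose V := U `&` ball x0 (r / 2).
have VU : V `<=` U by move=> y [].
have oV : open V.
  by apply: openI => //; apply: ball_open; rewrite divr_gt0.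
have Vx : V x0 by split; [exact: proj2_sig|apply: ballxx; rewrite divr_gt0].
exists V, VU; split=> // y.
have [//|[j [d Pd]]] := skelS_cover (hP (exist _ (proj1_sig y) (VU _ (proj2_sig y)))).
have [dS|nS] := pselect (@Sph R N (cdim j) (proj1_sig d)).
  have <- : proj1_sig (att (exist _ _ dS)) = prestr VU P y.
    rewrite [RHS]Pd -(chr_att dS (proj2_sig d)).
    by congr (proj1_sig (chr _)); exact: exist_eq.
  exact: proj2_sig.
have Ay : A j (proj1_sig y) by exists (VU _ (proj2_sig y)), d.
have Aj : exists y', A j y' by exists (proj1_sig y).
have [_ /(_ _ Ay)] := xjP j Aj.
have := xj_far j Aj.
have [_] := proj2_sig y; rewrite -ball_normE /ball_ /=.
by lra.
Qed.

Lemma skel_reflexive N k (U : set 'rV[R]_k) (P : {x | U x} -> X) :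
  skel_preplot N P -> dplot P.
Proof.
elim: N k U P => [|N IH] k U P pP.
  have [oU hP _] := pP; apply: plot_local => // x.
  by have := hP x; rewrite skel0.
have [oU hP sP] := pP; apply: plot_local => // x.
have [[j [d Px]]|nchr] := pselect (exists (j : cells C N)
    (d : {d | @Disk R N (cdim j) d}), P x = proj1_sig (chr d)).
  by have [V [VU [oV Vx dV]]] := skel_preplot_chart pP Px; exists V, VU.
have [|V [VU [oV Vx hV]]] := @skel_preplot_lower N k U P x pP.
  by move=> j d Px; apply: nchr; exists j, d.
exists V, VU; split; [exact: oV|split; first exact: Vx].
apply: IH; split; [exact: oV|exact: hV|] => f sf.
have [g sg gE] := smooth_skel_extension sf.
have -> : f \o prestr VU P = prestr VU (g \o P).
  by apply/funext => y /=; rewrite -gE.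
exact: smooth_sub_prestr oV (sP g sg).
Qed.

End Reflexivity.

Theorem theorem8p1 (R : realType) (X : dspace R) (C : fatCW X) :
  regularCW C -> (exists n : nat, skel C n.+1 = setT) -> dreflexive X.
Proof.
move=> regC [n skn] k U P [oU sP].
have skT x : skel C n.+1 x by rewrite skn.
apply: (skel_reflexive regC (N := n.+1)); split; [exact: oU|by []|].
(* All plots of X lie in the top skeleton, so a function smooth on that skeleton is smooth on X. *)
move=> f sf; apply: sP => k' U' P' dP'; exact: sf.
Qed.
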